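(* Let $\alpha,\beta$ be real numbers with $0<\alpha<2$, $0<\beta<2$ and $\alpha\beta<2$. Let $\mu\in\mathbb{C}$ be arbitrary, let $\epsilon>0$, and let $\theta$ be a real number satisfying $$\frac{\pi\alpha\beta}{2}<\theta\le \min(\pi,\pi\alpha\beta).$$ Put $\epsilon_\alpha:=\epsilon^{1/\beta}$, $\epsilon_\beta:=\epsilon^{1/\alpha}$, $\theta_\alpha:=\theta/\beta$, $\theta_\beta:=\theta/\alpha$, and assume $\theta_\alpha<\pi$ and $\theta_\beta<\pi$ (so that the regions below are defined). If $x\in\Omega^{(-)}(\epsilon_\alpha;\theta_\alpha)$ and $y\in\Omega^{(-)}(\epsilon_\beta;\theta_\beta)$, then $$E_{\alpha,\beta}(x,y;\mu)=\frac{1}{2\pi i}\,\frac{1}{\alpha\beta}\int_{\gamma(\epsilon;\theta)}\frac{e^{\zeta^{1/(\alpha\beta)}}\,\zeta^{\frac{1+\alpha+\beta-\mu}{\alpha\beta}-1}}{(\zeta^{1/\alpha}-y)(\zeta^{1/\beta}-x)}\,d\zeta .$$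
   Context: For $\alpha,\beta,\mu\in\mathbb{C}$ with $\Re(\alpha),\Re(\beta)>0$ and $x,y\in\mathbb{C}$, the generalized Mittag-Leffler type function of two variables is the entire function $$E_{\alpha,\beta}(x,y;\mu):=\sum_{n,m\ge 0}\frac{x^n y^m}{\Gamma(n\alpha+m\beta+\mu)},$$ with the convention $1/\Gamma=0$ at the poles of $\Gamma$. For $\epsilon>0$ and $0<\theta\le\pi$, the Hankel contour $\gamma(\epsilon;\theta)$ consists of the ray $\{\arg\zeta=-\theta,\ |\zeta|\ge\epsilon\}$, the circular arc $\{|\zeta|=\epsilon,\ -\theta\le\arg\zeta\le\theta\}$ and the ray $\{\arg\zeta=\theta,\ |\zeta|\ge\epsilon\}$, oriented by non-decreasing $\arg\zeta$ (it comes in from infinity along the ray $\arg\zeta=-\theta$, traverses the arc counterclockwise, and goes out to infinity along the ray $\arg\zeta=\theta$). If $\theta=\pi$, the contour is the circle $|\zeta|=\epsilon$ together with the ray $-\infty<\zeta\le-\epsilon$ traversed twice (with $\arg\zeta=-\pi$ inward and $\arg\zeta=\pi$ outward). For $0<\theta<\pi$ the contour $\gamma(\epsilon;\theta)$ divides the complex plane into two unbounded regions: $\Omega^{(-)}(\epsilon;\theta)$, to the left of the contour by orientation, i.e. $\{|z|<\epsilon\}\cup\{z\neq0:\ \theta<|\arg z|\le\pi\}$; and $\Omega^{(+)}(\epsilon;\theta)$, to the right of it, i.e. $\{|z|>\epsilon,\ |\arg z|<\theta\}$. Powers $\zeta^{s}$ on the contour are $\exp(s(\ln|\zeta|+i\arg\zeta))$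 with the value of $\arg\zeta\in[-\theta,\theta]$ given by the parametrization of the contour. *)

(* Defs.v *)
From Stdlib Require Export Reals Factorial List ClassicalEpsilon.
From Coquelicot Require Export Coquelicot.
Export ListNotations.
Open Scope R_scope.

Definition Cexp (z : C) : C :=
  (exp (Re z) * cos (Im z), exp (Re z) * sin (Im z)).

(** Principal argument, with values in (-PI, PI]; meaningful for [z <> 0]. *)
Definition Carg (z : C) : R :=
  if Rle_dec 0 (Im z) then acos (Re z / Cmod z) else - acos (Re z / Cmod z).

(** [rising z n] is z (z+1) ... (z+n), with n+1 factors. *)
Fixpoint rising (z : C) (n : nat) : C :=
  match n with
  | O => z
  | S k => (rising z k * (z + RtoC (INR n)))%C
  end.

(** The Gamma function, given on all of C minus its poles 0, -1, -2, ... by the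
    Euler-Gauss limit of n! n^z / (z (z+1) ... (z+n)). The value at the poles
    is meaningless. *)
Definition Gauss_seq (z : C) (n : nat) : C :=
  (RtoC (INR (fact n)) * Cexp (z * RtoC (ln (INR n))) / rising z n)%C.

Definition CGamma (z : C) : C :=
  iota (T := C_CompleteNormedModule)
    (fun l => filterlim (Gauss_seq z) eventually (locally l)).

Definition Gamma_pole (z : C) : Prop := exists k : nat, z = RtoC (- INR k).

(** 1 / Gamma, with the convention that it vanishes at the poles of Gamma. *)
Definition inv_Gamma (z : C) : C :=
  if excluded_middle_informative (Gamma_pole z) then RtoC 0 else (/ CGamma z)%C.

(** Unconditional (unordered) summation over all pairs (n, m) of naturals:
    the finite partial sums converge to [l] along the net of finite sets of
    pairs, a finite set being represented by a duplicate-free list. *)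
Definition sum_pairs (a : nat -> nat -> C) (L : list (nat * nat)) : C :=
  fold_right Cplus (RtoC 0) (map (fun p => a (fst p) (snd p)) L).

Definition is_double_series (a : nat -> nat -> C) (l : C) : Prop :=
  forall e : R, 0 < e ->
    exists L0 : list (nat * nat),
      forall L : list (nat * nat), NoDup L -> incl L0 L ->
        Cmod (sum_pairs a L - l) < e.

Definition Double_series (a : nat -> nat -> C) : C :=
  iota (T := C_CompleteNormedModule) (is_double_series a).

(** The Mittag-Leffler type function E_{alpha,beta}(x, y; mu). *)
Definition mittag_leffler2 (alpha beta x y mu : C) : C :=
  Double_series (fun n m =>
    (x ^ n * y ^ m
     * inv_Gamma (RtoC (INR n) * alpha + RtoC (INR m) * beta + mu))%C).

(** A point of the contour is given by its polar coordinates (r, t), where t is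
    the value of its argument carried by the parametrization. Functions on the
    contour take these coordinates rather than the point itself: for
    theta = PI the points (r, PI) and (r, -PI) coincide, while the powers
    differ on the two sides of the cut. *)
Definition polar_pow (r t : R) (s : C) : C :=
  Cexp (s * (RtoC (ln r) + Ci * RtoC t)).

(** [is_hankel_integral f eps theta l]: the integral of f along
    gamma(eps; theta) converges, with value l. The three pieces are the ray
    arg = -theta traversed from infinity to eps, the arc, and the ray
    arg = theta traversed from eps to infinity; the factor [Cexp (Ci * t)] is
    d zeta / d r on a ray, and [Ci * eps * Cexp (Ci * t)] is d zeta / d t on
    the arc. *)
Definition is_hankel_integral (f : R -> R -> C) (eps theta : R) (l : C) : Prop :=
  exists l_in l_arc l_out : C,
    is_RInt_gen (V := C_R_NormedModule)
      (fun r => f r (- theta)%R * Cexp (Ci * RtoC (- theta)))%C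
      (Rbar_locally p_infty) (at_point eps) l_in /\
    is_RInt (V := C_R_NormedModule)
      (fun t => f eps t * (Ci * RtoC eps * Cexp (Ci * RtoC t)))%C
      (- theta) theta l_arc /\
    is_RInt_gen (V := C_R_NormedModule)
      (fun r => f r theta * Cexp (Ci * RtoC theta))%C
      (at_point eps) (Rbar_locally p_infty) l_out /\
    l = (l_in + l_arc + l_out)%C.

(** The region to the left of gamma(eps; theta), for 0 < theta < PI. *)
Definition Omega_minus (eps theta : R) (z : C) : Prop :=
  Cmod z < eps \/
  (z <> RtoC 0 /\ theta < Rabs (Carg z) /\ Rabs (Carg z) <= PI).

(* Main.v *)
Require Import Defs.
From Stdlib Require Import Lra Lia Psatz Permutation FinFun.

(** Substitute [zeta = w^(alpha beta)] and then [w = exp s]: the contour becomes the boundary of the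
    half-strip [Re s >= a, |Im s| <= phi], with [PI / 2 < phi <= PI]. The hypothesis on [x] and [y]
    says that the integrand has no pole in this closed half-strip, so Cauchy's theorem on rectangles
    moves the contour so far to the right that both [|x w^(-alpha)|] and [|y w^(-beta)|] are at most
    1/2. There the integrand is [exp(w) w^(-mu)] times a double geometric series in these
    quantities, which is integrated term by term with Hankel's formula for [1 / Gamma].

    Hankel's formula itself is compared with the Euler-Gauss limit as follows. The contour integral
    [H(z)] of [exp(w) w^(-z) dw] satisfies [H(z) = z H(z+1)] (integrate an exact derivative) and
    [H(1) = 2 pi i], so [H(z)] is the product [z (z+1) ... (z+n)] times [H(z+n+1)], and it
    remains to see that [n! n^z H(z+n+1)] tends to [2 pi i]. On the contour of radius [n] the
    integrand concentrates at [w = n], where the factor [(w/n)^(-z)] is [1 + O(|arg w|)], so that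
    the value is asymptotically the one for [z = 0], which is known exactly. *)

(** The logarithmic coordinate removes every branch question: powers of [zeta] become exponentials
    of linear functions of [s], and the two sides of the cut at [theta = PI] become two different
    horizontal lines. The lower bound on [theta] reads [PI / 2 < phi], which makes [exp w] decay
    doubly exponentially in [Re s] along the rays.

    The obstacle is that [1 / Gamma] is given only through the Euler-Gauss limit, so Hankel's
    formula has to be proved for all complex [z], poles included. Comparing [z] with 0 on the
    contour of radius [n] avoids the evaluation of a saddle-point integral: the constant sqrt(2 pi)
    never appears. The difference of the two integrands carries an extra factor O(|t|), so its
    integral is O(e^n / n), and the one-sided Stirling bound n! <= e sqrt(n) (n/e)^n then leaves an
    error O(n^(-1/2)).

    Unconditional convergence of the double series needs no separate growth estimate for Gamma
    either: each term is itself a contour integral, bounded by a multiple of 2^(-n-m). *)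

(** * The complex exponential *)

Lemma C_eq (a b c d : R) : a = c -> b = d -> (a, b) = (c, d) :> C.
Proof. now intros -> ->. Qed.

Lemma exp_le (a b : R) : a <= b -> exp a <= exp b.
Proof. intros [H | ->]; [now apply Rlt_le, exp_increasing | apply Rle_refl]. Qed.

Lemma RtoC_neq_0 (r : R) : r <> 0 -> RtoC r <> RtoC 0.
Proof. intros H E. now apply H, RtoC_inj. Qed.

Lemma pair_RtoC (u t : R) : (u, t) = (RtoC u + Ci * RtoC t)%C.
Proof. unfold Ci, RtoC, Cplus, Cmult; simpl; apply C_eq; ring. Qed.

Lemma Cexp_plus (a b : C) : Cexp (a + b) = (Cexp a * Cexp b)%C.
Proof.
destruct a as [a1 a2], b as [b1 b2]; unfold Cexp, Cplus, Cmult; simpl.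
rewrite exp_plus, cos_plus, sin_plus; apply C_eq; ring.
Qed.

Lemma Cexp_RtoC (a : R) : Cexp (RtoC a) = RtoC (exp a).
Proof. unfold Cexp, RtoC; simpl. rewrite cos_0, sin_0; apply C_eq; ring. Qed.

Lemma Cexp_0 : Cexp (RtoC 0) = RtoC 1.
Proof. now rewrite Cexp_RtoC, exp_0. Qed.

Lemma Cmod_Cexp (z : C) : Cmod (Cexp z) = exp (Re z).
Proof.
unfold Cmod, Cexp; simpl.
replace (_ + _) with (Rsqr (exp (Re z)) * (Rsqr (sin (Im z)) + Rsqr (cos (Im z))))
  by (unfold Rsqr; ring).
rewrite sin2_cos2, Rmult_1_r. apply sqrt_Rsqr, Rlt_le, exp_pos.
Qed.

Lemma Cexp_neq_0 (z : C) : Cexp z <> RtoC 0.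
Proof. apply Cmod_gt_0. rewrite Cmod_Cexp. apply exp_pos. Qed.

Lemma Cexp_opp (z : C) : Cexp (- z) = (/ Cexp z)%C.
Proof.
transitivity (Cexp (z + - z) * / Cexp z)%C.
- rewrite Cexp_plus. field. apply Cexp_neq_0.
- rewrite Cplus_opp_r, Cexp_0. apply Cmult_1_l.
Qed.

Lemma Cexp_pow (z : C) (n : nat) : (Cexp z ^ n)%C = Cexp (RtoC (INR n) * z).
Proof.
induction n as [|n IH].
- simpl. now rewrite Cmult_0_l, Cexp_0.
- rewrite Cpow_S, IH, <- Cexp_plus, S_INR, RtoC_plus. f_equal. ring.
Qed.

Lemma im_le_Cmod (c : C) : Rabs (Im c) <= Cmod c.
Proof. eapply Rle_trans; [ | apply Rmax_Cmod]. apply Rmax_r. Qed.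

(** * Derivatives along curves and complex derivatives *)

Definition Ccurve_derive (f : R -> C) (x : R) (l : C) : Prop :=
  is_derive (K := R_AbsRing) (V := C_R_NormedModule) f x l.

(** Through the two real components, the product, exponential and quotient rules below reduce to
    their real versions. *)
Lemma Ccurve_derive_pair (f : R -> C) (x : R) (l : C) :
  Ccurve_derive f x l <->
  is_derive (fun y => fst (f y)) x (fst l) /\ is_derive (fun y => snd (f y)) x (snd l).
Proof.
unfold Ccurve_derive. split.
- intros H. split.
  + eapply filterdiff_ext_lin.
    apply (filterdiff_comp (V := C_R_NormedModule) (W := R_NormedModule) f (fun c : C => fst c)
      _ (fun c : C => fst c) H).
    apply filterdiff_linear, is_linear_fst.
    intros y. reflexivity.
  + eapply filterdiff_ext_lin.
    apply (filterdiff_comp (V := C_R_NormedModule) (W := R_NormedModule) f (fun c : C => snd c)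
      _ (fun c : C => snd c) H).
    apply filterdiff_linear, is_linear_snd.
    intros y. reflexivity.
- intros [H1 H2].
  eapply (filterdiff_ext (V := C_R_NormedModule) (fun y => (fst (f y), snd (f y)))).
  { intros y. now destruct (f y). }
  eapply filterdiff_ext_lin.
  apply (filterdiff_comp_2 (V := R_NormedModule) (W := C_R_NormedModule) (fun y => fst (f y))
    (fun y => snd (f y)) (fun a b => (a, b) : C) _ _ (fun a b => (a, b) : C) H1 H2).
  { eapply filterdiff_ext_lin.
    apply (filterdiff_ext (U := prod_NormedModule R_AbsRing R_NormedModule R_NormedModule)
      (V := C_R_NormedModule) (fun p => p)).
    intros [a b]; reflexivity.
    apply filterdiff_id.
    intros [a b]; reflexivity. }
  intros y. now destruct l.
Qed.

Lemma Ccurve_derive_const (a : C) (x : R) : Ccurve_derive (fun _ => a) x (RtoC 0).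
Proof. apply Ccurve_derive_pair; split; apply (is_derive_const (V := R_NormedModule)). Qed.

Lemma Ccurve_derive_plus (f g : R -> C) (x : R) (lf lg : C) :
  Ccurve_derive f x lf -> Ccurve_derive g x lg ->
  Ccurve_derive (fun y => f y + g y)%C x (lf + lg)%C.
Proof.
rewrite !Ccurve_derive_pair. intros [F1 F2] [G1 G2]; split;
  apply (is_derive_plus (V := R_NormedModule)); assumption.
Qed.

Lemma Ccurve_derive_opp (f : R -> C) (x : R) (lf : C) :
  Ccurve_derive f x lf -> Ccurve_derive (fun y => - f y)%C x (- lf)%C.
Proof.
rewrite !Ccurve_derive_pair. intros [F1 F2]; split;
  apply (is_derive_opp (V := R_NormedModule)); assumption.
Qed.

Lemma Ccurve_derive_mult (f g : R -> C) (x : R) (lf lg : C) :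
  Ccurve_derive f x lf -> Ccurve_derive g x lg ->
  Ccurve_derive (fun y => f y * g y)%C x (lf * g x + f x * lg)%C.
Proof.
rewrite !Ccurve_derive_pair. intros [F1 F2] [G1 G2]; split; simpl.
- evar_last.
  apply (is_derive_minus (V := R_NormedModule));
   apply (is_derive_mult (K := R_AbsRing)); try eassumption; intros; apply Rmult_comm.
  unfold minus, plus, opp, mult; simpl. ring.
- evar_last.
  apply (is_derive_plus (V := R_NormedModule));
   apply (is_derive_mult (K := R_AbsRing)); try eassumption; intros; apply Rmult_comm.
  unfold minus, plus, opp, mult; simpl. ring.
Qed.

Lemma Ccurve_derive_Cexp (f : R -> C) (x : R) (l : C) :
  Ccurve_derive f x l -> Ccurve_derive (fun y => Cexp (f y)) x (l * Cexp (f x))%C.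
Proof.
rewrite !Ccurve_derive_pair. intros [F1 F2].
assert (E : is_derive (fun y => exp (fst (f y))) x (fst l * exp (fst (f x)))).
{ apply (is_derive_comp (K := R_AbsRing) (V := R_NormedModule) exp); [apply is_derive_exp
    | exact F1]. }
assert (Cs : is_derive (fun y => cos (snd (f y))) x (snd l * - sin (snd (f x)))).
{ apply (is_derive_comp (K := R_AbsRing) (V := R_NormedModule) cos); [apply is_derive_cos
    | exact F2]. }
assert (Sn : is_derive (fun y => sin (snd (f y))) x (snd l * cos (snd (f x)))).
{ apply (is_derive_comp (K := R_AbsRing) (V := R_NormedModule) sin); [apply is_derive_sin
    | exact F2]. }
split; simpl; evar_last;
 [apply (is_derive_mult (K := R_AbsRing)); try eassumption; intros; apply Rmult_comm | |
  apply (is_derive_mult (K := R_AbsRing)); try eassumption; intros; apply Rmult_comm | ];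
 unfold plus, mult, Re, Im; simpl; ring.
Qed.

Lemma Ccurve_derive_inv (f : R -> C) (x : R) (l : C) :
  f x <> RtoC 0 -> Ccurve_derive f x l ->
  Ccurve_derive (fun y => / f y)%C x (- l / (f x * f x))%C.
Proof.
intros H0. rewrite !Ccurve_derive_pair. intros [F1 F2].
assert (N0 : fst (f x) * fst (f x) + snd (f x) * snd (f x) <> 0).
{ intros E. apply H0. destruct (f x) as [a b]; simpl in E.
  assert (a = 0) by nra. assert (b = 0) by nra. now subst. }
assert (N : is_derive (fun y => fst (f y) ^ 2 + snd (f y) ^ 2) x
   (2 * fst (f x) * fst l + 2 * snd (f x) * snd l)).
{ evar_last. apply (is_derive_plus (V := R_NormedModule)); apply (is_derive_pow); eassumption.
  unfold plus; simpl; ring. }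
split; simpl; evar_last;
 [apply is_derive_div; [eassumption | exact N | simpl; nra] |
 | apply is_derive_div; [apply (is_derive_opp (V := R_NormedModule)); eassumption | exact N
   | simpl; nra] | ];
 unfold opp; simpl; field; repeat split; try nra.
Qed.

(** [l] is the complex derivative of [G] at [s], tested along differentiable curves. *)
Definition cderiv (G : C -> C) (s l : C) : Prop :=
  forall (f : R -> C) (x : R) (v : C),
    f x = s -> Ccurve_derive f x v -> Ccurve_derive (fun y => G (f y)) x (l * v)%C.

Lemma cderiv_const (c s : C) : cderiv (fun _ => c) s (RtoC 0).
Proof.
intros f x v _ _. rewrite Cmult_0_l. apply Ccurve_derive_const.
Qed.

Lemma cderiv_id (s : C) : cderiv (fun z => z) s (RtoC 1).
Proof. intros f x v _ H. now rewrite Cmult_1_l. Qed.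

Lemma cderiv_eq (G : C -> C) (s l l' : C) : cderiv G s l -> l = l' -> cderiv G s l'.
Proof. now intros H <-. Qed.

Lemma cderiv_plus (F G : C -> C) (s l m : C) :
  cderiv F s l -> cderiv G s m -> cderiv (fun z => F z + G z)%C s (l + m)%C.
Proof.
intros HF HG f x v Hx Hv.
replace ((l + m) * v)%C with (l * v + m * v)%C by ring.
apply Ccurve_derive_plus; [now apply HF | now apply HG].
Qed.

Lemma cderiv_opp (F : C -> C) (s l : C) :
  cderiv F s l -> cderiv (fun z => - F z)%C s (- l)%C.
Proof.
intros HF f x v Hx Hv.
replace (- l * v)%C with (- (l * v))%C by ring.
now apply Ccurve_derive_opp, HF.
Qed.

Lemma cderiv_minus (F G : C -> C) (s l m : C) :
  cderiv F s l -> cderiv G s m -> cderiv (fun z => F z - G z)%C s (l - m)%C.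
Proof. intros HF HG. now apply cderiv_plus; [ | apply cderiv_opp]. Qed.

Lemma cderiv_mult (F G : C -> C) (s l m : C) :
  cderiv F s l -> cderiv G s m ->
  cderiv (fun z => F z * G z)%C s (l * G s + F s * m)%C.
Proof.
intros HF HG f x v Hx Hv. rewrite <- Hx.
replace ((l * G (f x) + F (f x) * m) * v)%C
  with ((l * v) * G (f x) + F (f x) * (m * v))%C by ring.
apply Ccurve_derive_mult; [now apply HF | now apply HG].
Qed.

Lemma cderiv_Cexp (F : C -> C) (s l : C) :
  cderiv F s l -> cderiv (fun z => Cexp (F z)) s (l * Cexp (F s))%C.
Proof.
intros HF f x v Hx Hv. rewrite <- Hx.
replace (l * Cexp (F (f x)) * v)%C with ((l * v) * Cexp (F (f x)))%C by ring.
now apply Ccurve_derive_Cexp, HF.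
Qed.

Lemma cderiv_inv (F : C -> C) (s l : C) :
  F s <> RtoC 0 -> cderiv F s l ->
  cderiv (fun z => / F z)%C s (- l / (F s * F s))%C.
Proof.
intros H0 HF f x v Hx Hv. rewrite <- Hx.
replace (- l / (F (f x) * F (f x)) * v)%C with (- (l * v) / (F (f x) * F (f x)))%C
  by (unfold Cdiv; ring).
apply Ccurve_derive_inv; [now rewrite Hx | now apply HF].
Qed.

Lemma Ccurve_horizontal (t x : R) : Ccurve_derive (fun u => (u, t)) x (RtoC 1).
Proof.
apply Ccurve_derive_pair; split; simpl.
- apply (is_derive_id (K := R_AbsRing)).
- apply (is_derive_const (V := R_NormedModule)).
Qed.

Lemma Ccurve_vertical (u x : R) : Ccurve_derive (fun t => (u, t)) x Ci.
Proof.
apply Ccurve_derive_pair; split; simpl.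
- apply (is_derive_const (V := R_NormedModule)).
- apply (is_derive_id (K := R_AbsRing)).
Qed.

Lemma cderiv_horizontal (G : C -> C) (u t : R) (l : C) :
  cderiv G (u, t) l -> Ccurve_derive (fun u => G (u, t)) u l.
Proof.
intros H. rewrite <- (Cmult_1_r l).
now apply (H (fun u => (u, t))), Ccurve_horizontal.
Qed.

Lemma cderiv_vertical (G : C -> C) (u t : R) (l : C) :
  cderiv G (u, t) l -> Ccurve_derive (fun t => G (u, t)) t (Ci * l)%C.
Proof.
intros H. rewrite (Cmult_comm Ci).
now apply (H (fun t => (u, t))), Ccurve_vertical.
Qed.

(** * Continuity of complex-valued maps *)

(** The source is an arbitrary uniform space because continuity is needed both along real lines and
    in the plane. *)
Definition Ccont {T : UniformSpace} (f : T -> C) (x : T) : Prop :=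
  continuous (T := T) (U := C_UniformSpace) f x.

Lemma Ccont_pair {T : UniformSpace} (f : T -> C) (x : T) :
  Ccont f x <-> continuous (fun y => fst (f y)) x /\ continuous (fun y => snd (f y)) x.
Proof.
split.
- intros H; split.
  + apply (continuous_comp (V := C_UniformSpace) f (fun c : C => fst c)); [exact H | ].
    apply (continuous_fst (U := R_UniformSpace) (V := R_UniformSpace)).
  + apply (continuous_comp (V := C_UniformSpace) f (fun c : C => snd c)); [exact H | ].
    apply (continuous_snd (U := R_UniformSpace) (V := R_UniformSpace)).
- intros [H1 H2].
  apply (continuous_ext (U := C_UniformSpace) (fun y => (fst (f y), snd (f y)))).
  { intros y. now destruct (f y). }
  apply (continuous_comp_2 (U := T) (V := R_UniformSpace) (W := R_UniformSpace)
    (X := C_UniformSpace)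
    (fun y => fst (f y)) (fun y => snd (f y)) (fun a b => (a, b) : C) x H1 H2).
  apply (continuous_ext (T := prod_UniformSpace R_UniformSpace R_UniformSpace)
    (U := C_UniformSpace) (fun p => p)).
  { now intros [a b]. }
  apply continuous_id.
Qed.

Lemma Ccont_const {T : UniformSpace} (c : C) (x : T) : Ccont (fun _ : T => c) x.
Proof. apply continuous_const. Qed.

Lemma Ccont_plus {T : UniformSpace} (f g : T -> C) (x : T) : Ccont f x -> Ccont g x ->
  Ccont (fun y => f y + g y)%C x.
Proof.
rewrite !Ccont_pair. intros [F1 F2] [G1 G2]; split;
  apply (continuous_plus (V := R_NormedModule)); assumption.
Qed.

Lemma Ccont_opp {T : UniformSpace} (f : T -> C) (x : T) : Ccont f x -> Ccont (fun y => - f y)%C x.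
Proof.
rewrite !Ccont_pair. intros [F1 F2]; split;
  apply (continuous_opp (V := R_NormedModule)); assumption.
Qed.

Lemma Ccont_minus {T : UniformSpace} (f g : T -> C) (x : T) : Ccont f x -> Ccont g x ->
  Ccont (fun y => f y - g y)%C x.
Proof. intros HF HG. now apply Ccont_plus; [ | apply Ccont_opp]. Qed.

Lemma Ccont_mult {T : UniformSpace} (f g : T -> C) (x : T) : Ccont f x -> Ccont g x ->
  Ccont (fun y => f y * g y)%C x.
Proof.
rewrite !Ccont_pair. intros [F1 F2] [G1 G2]; split.
- apply (continuous_minus (V := R_NormedModule));
   apply (continuous_mult (K := R_AbsRing)); assumption.
- apply (continuous_plus (V := R_NormedModule));
   apply (continuous_mult (K := R_AbsRing)); assumption.
Qed.

Lemma Ccont_Cexp {T : UniformSpace} (f : T -> C) (x : T) : Ccont f x ->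
  Ccont (fun y => Cexp (f y)) x.
Proof.
rewrite !Ccont_pair. intros [F1 F2].
assert (E : continuous (fun y => exp (fst (f y))) x).
{ apply (continuous_comp _ exp); [exact F1 | apply continuous_exp]. }
assert (Cs : continuous (fun y => cos (snd (f y))) x).
{ apply (continuous_comp _ cos); [exact F2 | apply continuous_cos]. }
assert (Sn : continuous (fun y => sin (snd (f y))) x).
{ apply (continuous_comp _ sin); [exact F2 | apply continuous_sin]. }
split; apply (continuous_mult (K := R_AbsRing)); assumption.
Qed.

Lemma Ccont_inv {T : UniformSpace} (f : T -> C) (x : T) : f x <> RtoC 0 -> Ccont f x ->
  Ccont (fun y => / f y)%C x.
Proof.
intros H0. rewrite !Ccont_pair. intros [F1 F2].
assert (N0 : fst (f x) ^ 2 + snd (f x) ^ 2 <> 0).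
{ intros E. apply H0. destruct (f x) as [a b]; simpl in E.
  assert (a = 0) by nra. assert (b = 0) by nra. now subst. }
assert (N : continuous (fun y => / (fst (f y) ^ 2 + snd (f y) ^ 2)) x).
{ apply (continuous_comp (fun y => fst (f y) ^ 2 + snd (f y) ^ 2) Rinv).
  - assert (S : forall g : T -> R, continuous g x -> continuous (fun y => g y ^ 2) x).
    { intros g Hg. apply (continuous_mult (K := R_AbsRing) g (fun y => g y * 1)); [exact Hg | ].
      apply (continuous_mult (K := R_AbsRing) g (fun _ => 1)); [exact Hg
        | apply continuous_const]. }
    apply (continuous_plus (V := R_NormedModule) (fun y => fst (f y) ^ 2) (fun y => snd (f y) ^ 2));
      now apply (S (fun y => _ (f y))).
  - now apply continuous_Rinv. }
split; apply (continuous_mult (K := R_AbsRing)); try assumption.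
now apply (continuous_opp (V := R_NormedModule)).
Qed.

Lemma Ccont_scal_exp {T : UniformSpace} (c : C) (f : T -> C) (x : T) : Ccont f x ->
  Ccont (fun y => Cexp (c * f y)) x.
Proof. intros H. apply Ccont_Cexp, Ccont_mult; [apply Ccont_const | exact H]. Qed.

Lemma Ccont_horizontal (t x : R) : Ccont (fun u => (u, t)) x.
Proof. apply Ccont_pair; split; [apply continuous_id | apply continuous_const]. Qed.

Lemma Ccont_vertical (u x : R) : Ccont (fun t => (u, t)) x.
Proof. apply Ccont_pair; split; [apply continuous_const | apply continuous_id]. Qed.

Lemma Ccurve_derive_cont (f : R -> C) (x : R) (l : C) : Ccurve_derive f x l -> Ccont f x.
Proof.
intros H. apply (ex_derive_continuous (V := C_R_NormedModule)). now exists l.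
Qed.

(** * Cauchy's theorem on rectangles *)

Definition CRInt (f : R -> C) (a b : R) (l : C) : Prop :=
  is_RInt (V := C_R_NormedModule) f a b l.

Lemma CRInt_pair (f : R -> C) (a b : R) (l1 l2 : R) :
  is_RInt (fun t => fst (f t)) a b l1 -> is_RInt (fun t => snd (f t)) a b l2 ->
  CRInt f a b (l1, l2).
Proof. intros H1 H2. now apply (is_RInt_fct_extend_pair (U := R_NormedModule)
  (V := R_NormedModule)). Qed.

Lemma CRInt_unique (f : R -> C) (a b : R) (l m : C) :
  CRInt f a b l -> CRInt f a b m -> l = m.
Proof.
intros H1 H2.
rewrite <- (is_RInt_unique (V := C_R_CompleteNormedModule) _ _ _ _ H1).
now apply (is_RInt_unique (V := C_R_CompleteNormedModule)).
Qed.

Lemma ex_CRInt (f : R -> C) (a b : R) :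
  (forall x, Rmin a b <= x <= Rmax a b -> Ccont f x) -> exists l, CRInt f a b l.
Proof. exact (ex_RInt_continuous (V := C_R_CompleteNormedModule) f a b). Qed.

Lemma CRInt_derive (f df : R -> C) (a b : R) :
  (forall x, Rmin a b <= x <= Rmax a b -> Ccurve_derive f x (df x)) ->
  (forall x, Rmin a b <= x <= Rmax a b -> Ccont df x) ->
  CRInt df a b (f b - f a)%C.
Proof. exact (is_RInt_derive (V := C_R_CompleteNormedModule) f df a b). Qed.

Lemma Ccont_continuity_2d (F : C -> R) (u t : R) :
  continuous (T := C_UniformSpace) F (u, t) -> continuity_2d_pt (fun u t => F (u, t)) u t.
Proof.
intros H. apply continuity_2d_pt_filterlim.
change (continuous (T := C_UniformSpace) (fun z => F (fst z, snd z)) (u, t)).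
apply (continuous_ext (T := C_UniformSpace) F); [now intros [x y] | exact H].
Qed.

(** The partial derivative must be continuous in both variables at every point of the segment,
    endpoints included. This is why it has to be identified with [F'] on a full neighbourhood of
    each point and not only inside the strip. *)
Lemma is_derive_RInt_strip (F F' : C -> R) (a0 c d u : R) :
  c <= d -> a0 < u ->
  (forall v t, a0 < v -> c <= t <= d ->
     locally (T := C_UniformSpace) (v, t)
       (fun s => is_derive (fun w => F (w, snd s)) (fst s) (F' s))) ->
  (forall v t, a0 < v -> c <= t <= d -> continuous (T := C_UniformSpace) F' (v, t)) ->
  (forall v t, a0 < v -> c <= t <= d -> continuous (fun t => F (v, t)) t) ->
  is_derive (fun v => RInt (fun t => F (v, t)) c d) u (RInt (fun t => F' (u, t)) c d).
Proof.
intros Hcd Hu HF HF' HFc.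
assert (Hloc : locally u (fun v => a0 < v)) by now apply (open_gt a0).
evar_last.
- apply (is_derive_RInt_param (fun v t => F (v, t)) c d u).
  + revert Hloc. apply filter_imp. intros v Hv t.
    rewrite Rmin_left, Rmax_right by easy. intros Ht.
    exists (F' (v, t)). exact (locally_singleton (T := C_UniformSpace) _ _ (HF v t Hv Ht)).
  + intros t. rewrite Rmin_left, Rmax_right by easy. intros Ht.
    apply (continuity_2d_pt_ext_loc (fun v t => F' (v, t))).
    * destruct (HF u t Hu Ht) as [e He].
      exists e. intros v w Hv Hw. symmetry. apply is_derive_unique.
      apply (He (v, w)). now split.
    * now apply Ccont_continuity_2d, HF'.
  + revert Hloc. apply filter_imp. intros v Hv.
    apply (ex_RInt_continuous (V := R_CompleteNormedModule)).
    intros t. rewrite Rmin_left, Rmax_right by easy. now apply HFc.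
- apply RInt_ext. intros t. rewrite Rmin_left, Rmax_right by easy. intros Ht.
  apply is_derive_unique.
  apply (locally_singleton (T := C_UniformSpace) _ _ (HF u t Hu (conj (Rlt_le _ _ (proj1 Ht))
    (Rlt_le _ _ (proj2 Ht))))).
Qed.

(** By differentiation under the integral sign: the derivative of the vertical integral with
    respect to the abscissa is the difference of the values of [G] at its endpoints. *)
Lemma Cauchy_rectangle (G G' : C -> C) (a0 c d a b : R) (la lb : C) :
  c <= d ->
  (forall u t, a0 < u -> c <= t <= d ->
     locally (T := C_UniformSpace) (u, t) (fun s => cderiv G s (G' s))) ->
  (forall u t, a0 < u -> c <= t <= d -> Ccont (T := C_UniformSpace) G' (u, t)) ->
  a0 < a -> a <= b ->
  CRInt (fun t => Ci * G (a, t))%C c d la ->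
  CRInt (fun t => Ci * G (b, t))%C c d lb ->
  CRInt (fun u => G (u, d) - G (u, c))%C a b (lb - la)%C.
Proof.
intros Hcd HG HG' Ha Hab Hla Hlb.
assert (HG1 : forall u t, a0 < u -> c <= t <= d -> cderiv G (u, t) (G' (u, t))).
{ intros u t Hu Ht. exact (locally_singleton (T := C_UniformSpace) _ _ (HG u t Hu Ht)). }
assert (Hc : forall u t, a0 < u -> c <= t <= d -> Ccont (fun t => G (u, t)) t).
{ intros u t Hu Ht. eapply Ccurve_derive_cont, cderiv_vertical, HG1; easy. }
assert (Hc' : forall u t, a0 < u -> c <= t <= d -> Ccont (fun t => G' (u, t)) t).
{ intros u t Hu Ht. apply (continuous_comp (fun t => (u, t) : C_UniformSpace) G').
  - apply Ccont_vertical.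
  - now apply HG'. }
set (P := fun u => RInt (fun t => fst (G (u, t))) c d).
set (Q := fun u => RInt (fun t => snd (G (u, t))) c d).
(* The vertical integral i (P + i Q), split into components so that each can be differentiated as a
   real parameter integral. *)
set (V := fun u => (- Q u, P u) : C).
assert (HV : forall u, a0 < u -> CRInt (fun t => Ci * G (u, t))%C c d (V u)).
{ intros u Hu.
  apply CRInt_pair; simpl.
  - apply (is_RInt_ext (fun t => opp (snd (G (u, t))))).
    { intros t _. unfold opp; simpl; ring. }
    apply (is_RInt_opp (V := R_NormedModule)), (RInt_correct (V := R_CompleteNormedModule)),
      (ex_RInt_continuous (V := R_CompleteNormedModule)).
    intros t. rewrite Rmin_left, Rmax_right by easy. intros Ht.
    now apply (Ccont_pair (fun t => G (u, t))), Hc.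
  - apply (is_RInt_ext (fun t => fst (G (u, t)))).
    { intros t _; simpl; ring. }
    apply (RInt_correct (V := R_CompleteNormedModule)),
      (ex_RInt_continuous (V := R_CompleteNormedModule)).
    intros t. rewrite Rmin_left, Rmax_right by easy. intros Ht.
    now apply (Ccont_pair (fun t => G (u, t))), Hc. }
rewrite (CRInt_unique _ _ _ _ _ Hla (HV a Ha)).
rewrite (CRInt_unique _ _ _ _ _ Hlb (HV b (Rlt_le_trans _ _ _ Ha Hab))).
(* Here the integrand is the exact [t]-derivative of [G], so the integral is a boundary difference;
   [E1] and [E2] read off its imaginary and real parts. *)
assert (HI : forall u, a0 < u ->
   CRInt (fun t => Ci * G' (u, t))%C c d (G (u, d) - G (u, c))%C).
{ intros u Hu. apply (CRInt_derive (fun t => G (u, t))).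
  - intros t. rewrite Rmin_left, Rmax_right by easy. intros Ht.
    now apply cderiv_vertical, HG1.
  - intros t. rewrite Rmin_left, Rmax_right by easy. intros Ht.
    apply Ccont_mult; [apply Ccont_const | now apply Hc']. }
assert (E1 : forall u, a0 < u ->
   RInt (fun t => fst (G' (u, t))) c d = snd (G (u, d) - G (u, c))%C).
{ intros u Hu. apply is_RInt_unique.
  eapply is_RInt_ext; [ | exact (is_RInt_fct_extend_snd (U := R_NormedModule)
    (V := R_NormedModule) _ _ _ _ (HI u Hu))].
  intros t _; simpl. ring. }
assert (E2 : forall u, a0 < u ->
   RInt (fun t => snd (G' (u, t))) c d = - fst (G (u, d) - G (u, c))%C).
{ intros u Hu. apply is_RInt_unique.
  eapply is_RInt_ext; [ | apply (is_RInt_opp (V := R_NormedModule));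
    exact (is_RInt_fct_extend_fst (U := R_NormedModule) (V := R_NormedModule) _ _ _ _ (HI u Hu))].
  intros t _; unfold opp; simpl. ring. }
apply CRInt_derive.
- intros u. rewrite Rmin_left, Rmax_right by easy. intros Hu.
  assert (Hu0 : a0 < u) by lra.
  apply Ccurve_derive_pair; split.
  + evar_last.
    apply (is_derive_opp (V := R_NormedModule)).
    apply (is_derive_RInt_strip (fun s => snd (G s)) (fun s => snd (G' s)) a0); try easy.
    * intros v t Hv Ht. generalize (HG v t Hv Ht). apply filter_imp.
      intros [w z] Hs. exact (proj2 (proj1 (Ccurve_derive_pair _ _ _)
        (cderiv_horizontal _ _ _ _ Hs))).
    * intros v t Hv Ht. exact (proj2 (proj1 (Ccont_pair _ _) (HG' v t Hv Ht))).
    * intros v t Hv Ht. exact (proj2 (proj1 (Ccont_pair _ _) (Hc v t Hv Ht))).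
    * simpl. rewrite (E2 u Hu0). unfold opp; simpl. ring.
  + evar_last.
    apply (is_derive_RInt_strip (fun s => fst (G s)) (fun s => fst (G' s)) a0); try easy.
    * intros v t Hv Ht. generalize (HG v t Hv Ht). apply filter_imp.
      intros [w z] Hs. exact (proj1 (proj1 (Ccurve_derive_pair _ _ _)
        (cderiv_horizontal _ _ _ _ Hs))).
    * intros v t Hv Ht. exact (proj1 (proj1 (Ccont_pair _ _) (HG' v t Hv Ht))).
    * intros v t Hv Ht. exact (proj1 (proj1 (Ccont_pair _ _) (Hc v t Hv Ht))).
    * simpl. rewrite (E1 u Hu0). reflexivity.
- intros u. rewrite Rmin_left, Rmax_right by easy. intros Hu.
  apply Ccont_minus; eapply Ccurve_derive_cont, cderiv_horizontal, HG1; lra.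
Qed.

(** * Hankel contours in the logarithmic coordinate *)

Lemma Cmod_CRInt_le (f : R -> C) (g : R -> R) (a b : R) (l : C) (lg : R) :
  a <= b -> (forall x, a <= x <= b -> Cmod (f x) <= g x) ->
  CRInt f a b l -> is_RInt g a b lg -> Cmod l <= lg.
Proof.
intros Hab Hfg Hf Hg. rewrite Cmod_norm.
apply (norm_RInt_le (V := C_R_NormedModule) f g a b l lg); try assumption.
intros x Hx. rewrite <- Cmod_norm. now apply Hfg.
Qed.

Lemma CRInt_plus (f g : R -> C) (a b : R) (l m : C) :
  CRInt f a b l -> CRInt g a b m -> CRInt (fun x => f x + g x)%C a b (l + m)%C.
Proof. exact (is_RInt_plus (V := C_R_NormedModule) f g a b l m). Qed.

Lemma CRInt_Chasles (f : R -> C) (a b c : R) (l m : C) :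
  CRInt f a b l -> CRInt f b c m -> CRInt f a c (l + m)%C.
Proof. exact (is_RInt_Chasles (V := C_R_NormedModule) f a b c l m). Qed.

Lemma CRInt_swap (f : R -> C) (a b : R) (l : C) :
  CRInt f b a l -> CRInt f a b (- l)%C.
Proof. exact (is_RInt_swap (V := C_R_NormedModule) f a b l). Qed.

Lemma CRInt_scal (c : C) (f : R -> C) (a b : R) (l : C) :
  CRInt f a b l -> CRInt (fun x => c * f x)%C a b (c * l)%C.
Proof.
intros H.
assert (H1 := is_RInt_fct_extend_fst (U := R_NormedModule) (V := R_NormedModule) _ _ _ _ H).
assert (H2 := is_RInt_fct_extend_snd (U := R_NormedModule) (V := R_NormedModule) _ _ _ _ H).
apply CRInt_pair.
- apply (is_RInt_minus (V := R_NormedModule)); now apply (is_RInt_scal (V := R_NormedModule)).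
- apply (is_RInt_plus (V := R_NormedModule)); now apply (is_RInt_scal (V := R_NormedModule)).
Qed.

Lemma CRInt_ext (f g : R -> C) (a b : R) (l : C) :
  (forall x, f x = g x) -> CRInt f a b l -> CRInt g a b l.
Proof. intros E. apply (is_RInt_ext (V := C_R_NormedModule)). intros x _. apply E. Qed.

Definition Cray (f : R -> C) (a : R) (l : C) : Prop :=
  is_RInt_gen (V := C_R_NormedModule) f (at_point a) (Rbar_locally p_infty) l.

(** The lower endpoint is fixed, so the filter on pairs of endpoints reduces to the limit in the
    upper one, and [Phi] matters only to the right of [a]. *)
Lemma Cray_lim (f Phi : R -> C) (a : R) (l : C) :
  (forall b, a <= b -> CRInt f a b (Phi b)) ->
  (Cray f a l <->
   filterlim Phi (Rbar_locally p_infty) (locally (T := C_UniformSpace) l)).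
Proof.
intros HPhi. split.
- intros H P HP.
  destruct (H P HP) as [Q S HQ [M HM] HQS].
  exists (Rmax a M). intros b Hb.
  assert (Hab : a <= b) by (generalize (Rmax_l a M); lra).
  assert (HMb : M < b) by (generalize (Rmax_r a M); lra).
  destruct (HQS a b HQ (HM b HMb)) as [y [Hy HPy]]; simpl in Hy.
  now rewrite (CRInt_unique _ _ _ _ _ (HPhi b Hab) Hy).
- intros H P HP.
  destruct (H P HP) as [M HM].
  apply (Filter_prod _ _ _ (fun x => x = a) (fun b => Rmax a M < b)).
  + reflexivity.
  + now exists (Rmax a M).
  + intros x b -> Hb; simpl.
    exists (Phi b). split.
    * apply HPhi. generalize (Rmax_l a M); lra.
    * apply HM. generalize (Rmax_r a M); lra.
Qed.

Lemma Cray_unique (f : R -> C) (a : R) (l m : C) : Cray f a l -> Cray f a m -> l = m.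
Proof.
intros H1 H2.
rewrite <- (is_RInt_gen_unique (V := C_R_CompleteNormedModule) (Fa := at_point a)
  (Fb := Rbar_locally p_infty) _ _ H1).
now apply (is_RInt_gen_unique (V := C_R_CompleteNormedModule)).
Qed.

Lemma Cray_plus (f g : R -> C) (a : R) (l m : C) :
  Cray f a l -> Cray g a m -> Cray (fun x => f x + g x)%C a (l + m)%C.
Proof.
exact (is_RInt_gen_plus (V := C_R_NormedModule)
  (Fa := at_point a) (Fb := Rbar_locally p_infty) f g l m).
Qed.

Lemma Cray_scal (c : C) (f : R -> C) (a : R) (l : C) :
  Cray f a l -> Cray (fun x => c * f x)%C a (c * l)%C.
Proof.
intros H P HP.
assert (Hc : Ccont (T := C_UniformSpace) (fun z => c * z)%C l).
{ apply Ccont_mult; [apply Ccont_const | apply continuous_id]. }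
generalize (H _ (Hc P HP)). unfold filtermapi. apply filter_imp.
intros [x y] [z [Hz HPz]]; simpl in Hz.
exists (c * z)%C. split; [now apply CRInt_scal | exact HPz].
Qed.

Lemma Cray_ext (f g : R -> C) (a : R) (l : C) :
  (forall x, f x = g x) -> Cray f a l -> Cray g a l.
Proof.
intros E H P HP. generalize (H P HP). unfold filtermapi. apply filter_imp.
intros [x y] [z [Hz HPz]]. exists z. split; [ | exact HPz].
now apply (CRInt_ext f).
Qed.

Lemma Cray_Chasles (f : R -> C) (a b : R) (l m : C) :
  CRInt f a b m -> Cray f a l -> Cray f b (l - m)%C.
Proof.
intros Hm Hl. unfold Cminus. rewrite Cplus_comm.
apply (is_RInt_gen_Chasles (V := C_R_NormedModule) (Fa := at_point b) (Fc := Rbar_locally p_infty)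
  f a); [ | exact Hl].
apply is_RInt_gen_at_point. now apply CRInt_swap.
Qed.

(** * Improper integrals with an exponential majorant *)

Lemma is_RInt_exp_opp (K a b : R) :
  is_RInt (fun u => K * exp (- u)) a b (K * exp (- a) - K * exp (- b)).
Proof.
replace (K * exp (- a) - K * exp (- b)) with (minus (- K * exp (- b)) (- K * exp (- a)))
  by (unfold minus, plus, opp; simpl; ring).
apply (is_RInt_derive (V := R_CompleteNormedModule) (fun u => - K * exp (- u))).
- intros u _. auto_derive; [easy | ring].
- intros u _. apply (continuous_mult (K := R_AbsRing)); [apply continuous_const | ].
  apply (continuous_comp _ exp); [ | apply continuous_exp].
  apply (continuous_opp (V := R_NormedModule)), continuous_id.
Qed.

Lemma exp_opp_small (K e : R) :
  0 <= K -> 0 < e -> exists M, forall b, M <= b -> K * exp (- b) < e.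
Proof.
intros HK He.
assert (H0 : 0 < e / (K + 1)) by (apply Rdiv_lt_0_compat; lra).
exists (- ln (e / (K + 1))). intros b Hb.
apply Rle_lt_trans with (K * (e / (K + 1))).
- apply Rmult_le_compat_l; [easy | ].
  rewrite <- (exp_ln (e / (K + 1))) by easy. apply exp_le. lra.
- apply Rmult_lt_reg_r with (K + 1); [lra | ].
  replace (K * (e / (K + 1)) * (K + 1)) with (K * e) by (field; lra). lra.
Qed.

Lemma Cmod_CRInt_exp_le (f : R -> C) (K a b : R) (l : C) :
  a <= b -> 0 <= K -> (forall u, a <= u -> Cmod (f u) <= K * exp (- u)) ->
  CRInt f a b l -> Cmod l <= K * exp (- a).
Proof.
intros Hab HK Hf Hl.
eapply Rle_trans.
- apply (Cmod_CRInt_le f (fun u => K * exp (- u)) a b); try eassumption.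
  + intros u Hu. now apply Hf.
  + apply is_RInt_exp_opp.
- generalize (Rmult_le_pos _ _ HK (Rlt_le _ _ (exp_pos (- b)))). lra.
Qed.

Lemma Cmod_lim_le {T : Type} {F : (T -> Prop) -> Prop} {FF : ProperFilter F}
  (f : T -> C) (l : C) (M : R) :
  filterlim f F (locally (T := C_UniformSpace) l) ->
  F (fun x => Cmod (f x) <= M) -> Cmod l <= M.
Proof.
intros Hl HM.
apply (filterlim_le (F := F) (fun x => Cmod (f x)) (fun _ => M) (Cmod l) M).
- exact HM.
- apply (filterlim_comp _ _ _ f Cmod F (locally (T := C_UniformSpace) l)); [exact Hl | ].
  rewrite Cmod_norm.
  apply (filterlim_ext (FF := @filter_filter _ _ (locally_filter (T := C_UniformSpace) l))
    (fun z : C_R_NormedModule => norm z)); [intros z; symmetry; apply Cmod_norm | ].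
  exact (filterlim_norm (V := C_R_NormedModule) l).
- apply filterlim_const.
Qed.

(** The tail of the majorant beyond [u] is [K * exp (- u)] itself, which gives the Cauchy criterion
    for the primitives. A single exponential is a convenient majorant: the integrands met on the
    rays decay doubly exponentially. *)
Lemma ex_Cray_exp (f : R -> C) (a K : R) :
  0 <= K -> (forall u, a <= u -> Ccont f u) ->
  (forall u, a <= u -> Cmod (f u) <= K * exp (- u)) ->
  exists l, Cray f a l.
Proof.
intros HK Hc Hf.
set (Phi := fun b => RInt (V := C_R_CompleteNormedModule) f a b).
assert (HPhi : forall b, a <= b -> CRInt f a b (Phi b)).
{ intros b Hb. apply (RInt_correct (V := C_R_CompleteNormedModule)).
  apply (ex_RInt_continuous (V := C_R_CompleteNormedModule)).
  intros u. rewrite Rmin_left by easy. intros Hu. now apply Hc. }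
enough (Hl : exists l, filterlim Phi (Rbar_locally p_infty) (locally (T := C_UniformSpace) l)).
{ destruct Hl as [l Hl]. exists l. now apply (Cray_lim f Phi). }
apply (filterlim_locally_cauchy (U := C_R_CompleteNormedModule)).
intros e.
destruct (exp_opp_small K e HK (cond_pos e)) as [M0 HM0].
set (M := Rmax a M0).
exists (fun b => M < b). split.
- now exists M.
- assert (W : forall u v, M < u -> u <= v -> Cmod (Phi v - Phi u)%C < e).
  { intros u v Hu Huv. apply Rle_lt_trans with (K * exp (- u)).
    - assert (Hau : a <= u) by (generalize (Rmax_l a M0); fold M; lra).
      apply (Cmod_CRInt_exp_le f K u v); try easy.
      + intros w Hw. apply Hf. lra.
      + replace (Phi v - Phi u)%C with (- Phi u + Phi v)%C by ring.
        apply (CRInt_Chasles f u a v); [apply CRInt_swap | ]; apply HPhi; lra.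
    - apply HM0. generalize (Rmax_r a M0); fold M; lra. }
  intros u v Hu Hv.
  destruct (Rle_dec u v) as [Huv | Huv].
  + apply C_NormedModule_mixin_compat1. now apply W.
  + apply (ball_sym (M := C_UniformSpace)), C_NormedModule_mixin_compat1. apply W; [easy | lra].
Qed.

Lemma Cmod_Cray_exp_le (f : R -> C) (a K : R) (l : C) :
  0 <= K -> (forall u, a <= u -> Ccont f u) ->
  (forall u, a <= u -> Cmod (f u) <= K * exp (- u)) ->
  Cray f a l -> Cmod l <= K * exp (- a).
Proof.
intros HK Hc Hf Hl.
set (Phi := fun b => RInt (V := C_R_CompleteNormedModule) f a b).
assert (HPhi : forall b, a <= b -> CRInt f a b (Phi b)).
{ intros b Hb. apply (RInt_correct (V := C_R_CompleteNormedModule)).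
  apply (ex_RInt_continuous (V := C_R_CompleteNormedModule)).
  intros u. rewrite Rmin_left by easy. intros Hu. now apply Hc. }
apply (Cmod_lim_le (F := Rbar_locally p_infty) Phi).
- exact (proj1 (Cray_lim f Phi a l HPhi) Hl).
- exists a. intros b Hb. apply (Cmod_CRInt_exp_le f K a b); try easy; [lra | apply HPhi; lra].
Qed.

(** The integral of [G(s) ds] along the two half-lines [Im s = -phi], [Im s = phi], [Re s >= a],
    joined by the segment [Re s = a]: for [G(s) = F(exp s) exp s] this is the integral of
    [F(w) dw] along the Hankel contour [gamma(exp a; phi)]. *)
Definition hankel (G : C -> C) (a phi : R) (l : C) : Prop :=
  exists l1 l2 l3 : C,
    Cray (fun u => G (u, (- phi)%R)) a l1 /\
    CRInt (fun t => Ci * G (a, t))%C (- phi) phi l2 /\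
    Cray (fun u => G (u, phi)) a l3 /\
    l = (- l1 + l2 + l3)%C.

Lemma hankel_unique (G : C -> C) (a phi : R) (l m : C) :
  hankel G a phi l -> hankel G a phi m -> l = m.
Proof.
intros (l1 & l2 & l3 & L1 & L2 & L3 & ->) (m1 & m2 & m3 & M1 & M2 & M3 & ->).
now rewrite (Cray_unique _ _ _ _ L1 M1), (Cray_unique _ _ _ _ L3 M3),
  (CRInt_unique _ _ _ _ _ L2 M2).
Qed.

Lemma hankel_ext (F G : C -> C) (a phi : R) (l : C) :
  (forall s, F s = G s) -> hankel F a phi l -> hankel G a phi l.
Proof.
intros E (l1 & l2 & l3 & L1 & L2 & L3 & ->).
exists l1, l2, l3. repeat split.
- eapply Cray_ext; [ | exact L1]; intros; apply E.
- eapply CRInt_ext; [ | exact L2]; intros; simpl; now rewrite E.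
- eapply Cray_ext; [ | exact L3]; intros; apply E.
Qed.

Lemma hankel_plus (F G : C -> C) (a phi : R) (l m : C) :
  hankel F a phi l -> hankel G a phi m ->
  hankel (fun s => F s + G s)%C a phi (l + m)%C.
Proof.
intros (l1 & l2 & l3 & L1 & L2 & L3 & ->) (m1 & m2 & m3 & M1 & M2 & M3 & ->).
exists (l1 + m1)%C, (l2 + m2)%C, (l3 + m3)%C. repeat split.
- now apply Cray_plus.
- eapply CRInt_ext; [ | exact (CRInt_plus _ _ _ _ _ _ L2 M2)]; intros; simpl; ring.
- now apply Cray_plus.
- ring.
Qed.

Lemma hankel_scal (c : C) (G : C -> C) (a phi : R) (l : C) :
  hankel G a phi l -> hankel (fun s => c * G s)%C a phi (c * l)%C.
Proof.
intros (l1 & l2 & l3 & L1 & L2 & L3 & ->).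
exists (c * l1)%C, (c * l2)%C, (c * l3)%C. repeat split.
- now apply Cray_scal.
- eapply CRInt_ext; [ | exact (CRInt_scal c _ _ _ _ L2)]; intros; simpl; ring.
- now apply Cray_scal.
- ring.
Qed.

Definition contour_cont (G : C -> C) (a phi : R) : Prop :=
  (forall t, - phi <= t <= phi -> Ccont (fun t => G (a, t)) t) /\
  (forall u, a <= u -> Ccont (fun u => G (u, (- phi)%R)) u) /\
  (forall u, a <= u -> Ccont (fun u => G (u, phi)) u).

(** One constant serves for the segment and for both rays, so that the bound on the contour integral
    in [Cmod_hankel_le] is linear in it and geometric factors pass from the integrand to the
    integral. *)
Definition contour_bounded (G : C -> C) (a phi M : R) : Prop :=
  (forall t, - phi <= t <= phi -> Cmod (G (a, t)) <= M) /\
  (forall u, a <= u -> Cmod (G (u, (- phi)%R)) <= M * exp (- u)) /\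
  (forall u, a <= u -> Cmod (G (u, phi)) <= M * exp (- u)).

Lemma ex_hankel (G : C -> C) (a phi M : R) :
  0 <= phi -> 0 <= M -> contour_cont G a phi -> contour_bounded G a phi M ->
  exists l, hankel G a phi l.
Proof.
intros Hphi HM (C1 & C2 & C3) (B1 & B2 & B3).
destruct (ex_Cray_exp (fun u => G (u, (- phi)%R)) a M) as [l1 L1]; try easy.
destruct (ex_Cray_exp (fun u => G (u, phi)) a M) as [l3 L3]; try easy.
destruct (ex_CRInt (fun t => Ci * G (a, t))%C (- phi) phi) as [l2 L2].
{ intros t. rewrite Rmin_left, Rmax_right by lra. intros Ht.
  apply Ccont_mult; [apply Ccont_const | now apply C1]. }
exists (- l1 + l2 + l3)%C, l1, l2, l3. now repeat split.
Qed.

Lemma Cmod_hankel_le (G : C -> C) (a phi M : R) (l : C) :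
  0 <= phi -> 0 <= M -> contour_cont G a phi -> contour_bounded G a phi M ->
  hankel G a phi l -> Cmod l <= M * (2 * phi + 2 * exp (- a)).
Proof.
intros Hphi HM (C1 & C2 & C3) (B1 & B2 & B3) (l1 & l2 & l3 & L1 & L2 & L3 & ->).
assert (N1 := Cmod_Cray_exp_le _ _ _ _ HM C2 B2 L1).
assert (N3 := Cmod_Cray_exp_le _ _ _ _ HM C3 B3 L3).
assert (N2 : Cmod l2 <= (phi - - phi) * M).
{ apply (Cmod_CRInt_le (fun t => Ci * G (a, t))%C (fun _ => M) (- phi) phi); [lra | | exact L2
    | apply (is_RInt_const (V := R_NormedModule))].
  intros t Ht. rewrite Cmod_mult, Cmod_Ci, Rmult_1_l. now apply B1. }
eapply Rle_trans; [apply Cmod_triangle | ].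
eapply Rle_trans; [apply Rplus_le_compat_r, Cmod_triangle | ].
rewrite Cmod_opp. lra.
Qed.

(** Neighbourhoods of the boundary points are included because differentiation under the integral
    sign needs them. The bound [a0 < u] leaves room to the left of a contour of abscissa
    [a > a0]. *)
Definition holo_strip (G G' : C -> C) (a0 c d : R) : Prop :=
  (forall u t, a0 < u -> c <= t <= d ->
     locally (T := C_UniformSpace) (u, t) (fun s => cderiv G s (G' s))) /\
  (forall u t, a0 < u -> c <= t <= d -> Ccont (T := C_UniformSpace) G' (u, t)).

Lemma holo_strip_cderiv (G G' : C -> C) (a0 c d u t : R) :
  holo_strip G G' a0 c d -> a0 < u -> c <= t <= d -> cderiv G (u, t) (G' (u, t)).
Proof.
intros [H _] Hu Ht. exact (locally_singleton (T := C_UniformSpace) _ _ (H u t Hu Ht)).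
Qed.

Lemma holo_strip_cont_h (G G' : C -> C) (a0 c d u t : R) :
  holo_strip G G' a0 c d -> a0 < u -> c <= t <= d -> Ccont (fun u => G (u, t)) u.
Proof. intros H Hu Ht. eapply Ccurve_derive_cont, cderiv_horizontal, holo_strip_cderiv; eauto. Qed.

Lemma holo_strip_cont_v (G G' : C -> C) (a0 c d u t : R) :
  holo_strip G G' a0 c d -> a0 < u -> c <= t <= d -> Ccont (fun t => G (u, t)) t.
Proof. intros H Hu Ht. eapply Ccurve_derive_cont, cderiv_vertical, holo_strip_cderiv; eauto. Qed.

Lemma holo_strip_contour_cont (G G' : C -> C) (a0 phi a : R) :
  0 <= phi -> holo_strip G G' a0 (- phi) phi -> a0 < a -> contour_cont G a phi.
Proof.
intros Hphi H Ha. repeat split.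
- intros t Ht. now apply (holo_strip_cont_v G G' a0 (- phi) phi).
- intros u Hu. apply (holo_strip_cont_h G G' a0 (- phi) phi); [easy | lra | lra].
- intros u Hu. apply (holo_strip_cont_h G G' a0 (- phi) phi); [easy | lra | lra].
Qed.

(** The rays lose their pieces between [a] and [b]. Cauchy's theorem on that rectangle, in the form
    [E], says that the change of segment compensates exactly for this. *)
Lemma hankel_shift (G G' : C -> C) (a0 a b phi : R) (l : C) :
  0 <= phi -> holo_strip G G' a0 (- phi) phi -> a0 < a -> a <= b ->
  hankel G a phi l -> hankel G b phi l.
Proof.
intros Hphi HG Ha Hab (l1 & l2 & l3 & L1 & L2 & L3 & ->).
destruct (ex_CRInt (fun u => G (u, (- phi)%R)) a b) as [m1 M1].
{ intros u. rewrite Rmin_left, Rmax_right by lra. intros Hu.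
  apply (holo_strip_cont_h G G' a0 (- phi) phi); [easy | lra | lra]. }
destruct (ex_CRInt (fun u => G (u, phi)) a b) as [m3 M3].
{ intros u. rewrite Rmin_left, Rmax_right by lra. intros Hu.
  apply (holo_strip_cont_h G G' a0 (- phi) phi); [easy | lra | lra]. }
destruct (ex_CRInt (fun t => Ci * G (b, t))%C (- phi) phi) as [m2 M2].
{ intros t. rewrite Rmin_left, Rmax_right by lra. intros Ht.
  apply Ccont_mult; [apply Ccont_const | ].
  apply (holo_strip_cont_v G G' a0 (- phi) phi); [easy | lra | lra]. }
exists (l1 - m1)%C, m2, (l3 - m3)%C. repeat split.
- now apply (Cray_Chasles _ a b).
- exact M2.
- now apply (Cray_Chasles _ a b).
- assert (E : (m2 - l2 = m3 - m1)%C).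
  { apply (CRInt_unique (fun u => G (u, phi) - G (u, (- phi)%R))%C a b).
    + destruct HG as [HG1 HG2].
      apply (Cauchy_rectangle G G' a0 (- phi) phi); try easy; lra.
    + assert (M1' := CRInt_scal (RtoC (-1)) _ _ _ _ M1).
      assert (M := CRInt_plus _ _ _ _ _ _ M3 M1').
      replace (m3 - m1)%C with (m3 + RtoC (-1) * m1)%C by ring.
      eapply CRInt_ext; [ | exact M]. intros u; simpl; ring. }
  replace m2 with (m3 - m1 + l2)%C by (rewrite <- E; ring). ring.
Qed.

(** Cauchy's theorem on the rectangle [a, b] x [c, d] with [b] tending to infinity: the far side
    contributes at most (d - c) K exp(-b). *)
Lemma Cray_rotate (G G' : C -> C) (a0 a c d K : R) (lc ld v : C) :
  c <= d -> holo_strip G G' a0 c d -> a0 < a -> 0 <= K ->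
  (forall u t, a <= u -> c <= t <= d -> Cmod (G (u, t)) <= K * exp (- u)) ->
  Cray (fun u => G (u, c)) a lc -> Cray (fun u => G (u, d)) a ld ->
  CRInt (fun t => Ci * G (a, t))%C c d v ->
  (ld - lc = - v)%C.
Proof.
intros Hcd HG Ha HK HB Lc Ld Hv.
set (V := (fun b => RInt (V := C_R_CompleteNormedModule) (fun t => Ci * G (b, t))%C c d) : R -> C).
assert (HV : forall b, a <= b -> CRInt (fun t => Ci * G (b, t))%C c d (V b)).
{ intros b Hb. apply (RInt_correct (V := C_R_CompleteNormedModule)).
  apply (ex_RInt_continuous (V := C_R_CompleteNormedModule)).
  intros t. rewrite Rmin_left, Rmax_right by lra. intros Ht.
  apply Ccont_mult; [apply Ccont_const | ].
  apply (holo_strip_cont_v G G' a0 c d); [easy | lra | lra]. }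
apply (Cray_unique (fun u => G (u, d) - G (u, c))%C a).
- replace (ld - lc)%C with (ld + RtoC (-1) * lc)%C by ring.
  eapply Cray_ext; [ | exact (Cray_plus _ _ _ _ _ Ld (Cray_scal (RtoC (-1)) _ _ _ Lc))].
  intros u; simpl; ring.
- apply (Cray_lim _ (fun b => V b - v)%C).
  + intros b Hb. destruct HG as [HG1 HG2].
    apply (Cauchy_rectangle G G' a0 c d); try easy. now apply HV.
  + apply (filterlim_ext_loc (fun b => - v + V b)%C).
    { exists a. intros b _. ring. }
    apply filterlim_locally. intros e.
    assert (HK' : 0 <= (d - c) * K) by (apply Rmult_le_pos; lra).
    destruct (exp_opp_small ((d - c) * K) e HK' (cond_pos e)) as [M0 HM0].
    exists (Rmax a M0). intros b Hb.
    assert (Hab : a <= b) by (generalize (Rmax_l a M0); lra).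
    apply C_NormedModule_mixin_compat1.
    replace (minus (- v + V b)%C (- v)%C) with (V b)
        by (unfold minus; change (V b = (- v + V b) + - - v)%C; ring).
    apply Rle_lt_trans with ((d - c) * (K * exp (- b))).
    * apply (Cmod_CRInt_le (fun t => Ci * G (b, t))%C (fun _ => K * exp (- b)) c d);
        [easy | | now apply HV | apply (is_RInt_const (V := R_NormedModule))].
      intros t Ht. rewrite Cmod_mult, Cmod_Ci, Rmult_1_l. now apply HB.
    * rewrite <- Rmult_assoc. apply HM0. generalize (Rmax_r a M0); lra.
Qed.

(** In the [w]-plane this turns the two rays inwards through sectors where the integrand decays. It
    links the contour around the cut, with angle [PI], to every smaller admissible angle. *)
Lemma hankel_rotate (G G' : C -> C) (a0 a phi psi K : R) (l : C) :
  0 <= phi <= psi -> holo_strip G G' a0 (- psi) psi -> a0 < a -> 0 <= K ->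
  (forall u t, a <= u -> phi <= Rabs t <= psi -> Cmod (G (u, t)) <= K * exp (- u)) ->
  hankel G a psi l -> hankel G a phi l.
Proof.
intros Hphi HG Ha HK HB (l1 & l2 & l3 & L1 & L2 & L3 & ->).
assert (HG1 : holo_strip G G' a0 (- psi) (- phi)).
{ destruct HG as [A B]; split; intros u t Hu Ht; [apply A | apply B]; lra. }
assert (HG3 : holo_strip G G' a0 phi psi).
{ destruct HG as [A B]; split; intros u t Hu Ht; [apply A | apply B]; lra. }
assert (HB1 : forall u t, a <= u -> - psi <= t <= - phi -> Cmod (G (u, t)) <= K * exp (- u)).
{ intros u t Hu Ht. apply HB; [easy | ]. rewrite Rabs_left1; lra. }
assert (HB3 : forall u t, a <= u -> phi <= t <= psi -> Cmod (G (u, t)) <= K * exp (- u)).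
{ intros u t Hu Ht. apply HB; [easy | ]. rewrite Rabs_right; lra. }
destruct (ex_Cray_exp (fun u => G (u, (- phi)%R)) a K) as [m1 M1]; [easy | | | ].
{ intros u Hu. apply (holo_strip_cont_h G G' a0 (- psi) psi); [easy | lra | lra]. }
{ intros u Hu. apply HB1; lra. }
destruct (ex_Cray_exp (fun u => G (u, phi)) a K) as [m3 M3]; [easy | | | ].
{ intros u Hu. apply (holo_strip_cont_h G G' a0 (- psi) psi); [easy | lra | lra]. }
{ intros u Hu. apply HB3; lra. }
assert (HI : forall c d, - psi <= c -> c <= d -> d <= psi -> exists v, CRInt (fun t => Ci * G (a,
  t))%C c d v).
{ intros c d Hc Hcd Hd. apply ex_CRInt. intros t. rewrite Rmin_left, Rmax_right by lra. intros Ht.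
  apply Ccont_mult; [apply Ccont_const | ].
  apply (holo_strip_cont_v G G' a0 (- psi) psi); [easy | lra | lra]. }
destruct (HI (- psi) (- phi)) as [v1 V1]; try lra.
destruct (HI (- phi) phi) as [v2 V2]; try lra.
destruct (HI phi psi) as [v3 V3]; try lra.
exists m1, v2, m3. repeat split; try easy.
assert (E : l2 = (v1 + (v2 + v3))%C).
{ apply (CRInt_unique _ _ _ _ _ L2).
  apply (CRInt_Chasles _ _ (- phi)); [easy | now apply (CRInt_Chasles _ _ phi)]. }
assert (E1 : (m1 - l1 = - v1)%C).
{ apply (Cray_rotate G G' a0 a (- psi) (- phi) K); try easy; lra. }
assert (E3 : (l3 - m3 = - v3)%C).
{ apply (Cray_rotate G G' a0 a phi psi K); try easy; lra. }
rewrite E.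
replace v1 with (- (m1 - l1))%C by (rewrite E1; ring).
replace v3 with (- (l3 - m3))%C by (rewrite E3; ring). ring.
Qed.

(** * Real estimates: Stirling's upper bound, Gaussian decay, double-exponential decay *)

(** This says that n! e^n n^(-n-1/2) is nonincreasing. With t = 1/x it becomes ln(1 + t) >= 2t/(2 +
    t), where the difference of the two sides vanishes at 0 and has a nonnegative derivative. *)
Lemma ln_step (x : R) : 0 < x -> 1 <= (x + 1 / 2) * (ln (x + 1) - ln x).
Proof.
intros Hx.
set (t := / x). assert (Ht : 0 < t) by now apply Rinv_0_lt_compat.
assert (H : 2 * t / (2 + t) <= ln (1 + t)).
{ destruct (MVT_gen (fun t => ln (1 + t) - 2 * t / (2 + t)) 0 t
    (fun t => t ^ 2 / ((1 + t) * (2 + t) ^ 2))) as [c [Hc E]].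
  - intros u. rewrite Rmin_left, Rmax_right by lra. intros Hu.
    auto_derive; [repeat split; lra | field; lra].
  - intros u. rewrite Rmin_left, Rmax_right by lra. intros Hu.
    apply continuity_pt_filterlim.
    apply (ex_derive_continuous (V := R_NormedModule) (fun t => ln (1 + t) - 2 * t / (2 + t))).
    auto_derive; repeat split; lra.
  - rewrite Rmin_left, Rmax_right in Hc by lra.
    replace (1 + 0) with 1 in E by ring. rewrite ln_1 in E.
    assert (0 <= c ^ 2 / ((1 + c) * (2 + c) ^ 2) * (t - 0)).
    { apply Rmult_le_pos; [ | lra]. apply Rle_mult_inv_pos; [apply pow2_ge_0 | ].
      apply Rmult_lt_0_compat; [lra | apply pow_lt; lra]. }
    replace (2 * 0 / (2 + 0)) with 0 in E by field. lra. }
replace (ln (x + 1) - ln x) with (ln (1 + t)).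
- apply Rle_trans with ((x + 1 / 2) * (2 * t / (2 + t))).
  + right. unfold t. field. lra.
  + apply Rmult_le_compat_l; lra.
- rewrite <- ln_div by lra. f_equal. unfold t. field. lra.
Qed.

(** Stirling's bound n! <= e sqrt(n) (n/e)^n, with equality at n = 1. The constant is harmless,
    since the bound only multiplies an error term. *)
Lemma fact_le_exp (n : nat) :
  (1 <= n)%nat ->
  INR (fact n) <= exp (1 + (INR n + 1 / 2) * ln (INR n) - INR n).
Proof.
induction 1 as [ | n Hn IH].
- simpl. rewrite ln_1. rewrite <- exp_0. apply exp_le. lra.
- change (fact (S n)) with (S n * fact n)%nat. rewrite mult_INR.
  assert (Hn0 : 0 < INR n) by (apply lt_0_INR; lia).
  rewrite S_INR. rewrite <- (exp_ln (INR n + 1)) at 1 by lra.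
  apply Rle_trans with (exp (ln (INR n + 1)) * exp (1 + (INR n + 1 / 2) * ln (INR n) - INR n)).
  + apply Rmult_le_compat_l; [apply Rlt_le, exp_pos | easy].
  + rewrite <- exp_plus. apply exp_le.
    generalize (ln_step (INR n) Hn0). lra.
Qed.

(** Since 1 - cos t = 2 sin(t/2)^2, it is enough that sin(t/2) >= t/6 on [0, PI]. The cubic Taylor
    bound t/2 - t^3/48 gives this as long as t <= 4. *)
Lemma cos_le_quadratic (t : R) : - PI <= t <= PI -> cos t <= 1 - t ^ 2 / 18.
Proof.
assert (W : forall t, 0 <= t <= PI -> cos t <= 1 - t ^ 2 / 18).
{ clear t. intros t Ht.
  replace t with (2 * (t / 2)) at 1 by field. rewrite cos_2a_sin.
  assert (Hs : t / 6 <= sin (t / 2)).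
  { eapply Rle_trans; [ | apply (sin_bound (t / 2) 0); lra].
    unfold sin_approx, sin_term; simpl.
    generalize PI_4. intros HP. nra. }
  nra. }
intros Ht. destruct (Rle_dec 0 t).
- apply W; lra.
- rewrite <- cos_neg. replace (t ^ 2) with ((- t) ^ 2) by ring. apply W; lra.
Qed.

Lemma gaussian_moment_le (c b K : R) (f : R -> C) (l : C) :
  0 < c -> 0 <= b -> 0 <= K ->
  (forall t, - b <= t <= b -> Cmod (f t) <= K * (Rabs t * exp (- c * t ^ 2))) ->
  CRInt f (- b) b l -> Cmod l <= K / c.
Proof.
intros Hc Hb HK Hf Hl.
assert (D : forall u v, is_RInt (fun t => K * (t * exp (- c * t ^ 2))) u v
   (K / (2 * c) * exp (- c * u ^ 2) - K / (2 * c) * exp (- c * v ^ 2))).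
{ intros u v.
  replace (_ - _) with (minus (- (K / (2 * c)) * exp (- c * v ^ 2)) (- (K / (2 * c))
    * exp (- c * u ^ 2)))
    by (unfold minus, plus, opp; simpl; ring).
  apply (is_RInt_derive (V := R_CompleteNormedModule) (fun t => - (K / (2 * c))
    * exp (- c * t ^ 2))).
  - intros t _. auto_derive; [easy | simpl; field; lra].
  - intros t _. apply (ex_derive_continuous (V := R_NormedModule)). auto_derive; easy. }
assert (I1 : is_RInt (fun t => K * (Rabs t * exp (- c * t ^ 2))) 0 b
   (K / (2 * c) * exp (- c * 0 ^ 2) - K / (2 * c) * exp (- c * b ^ 2))).
{ eapply is_RInt_ext; [ | apply D].
  intros t. rewrite Rmin_left, Rmax_right by easy. intros Ht. now rewrite Rabs_right by lra. }
assert (I2 : is_RInt (fun t => K * (Rabs t * exp (- c * t ^ 2))) (- b) 0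
   (opp (K / (2 * c) * exp (- c * (- b) ^ 2) - K / (2 * c) * exp (- c * 0 ^ 2)))).
{ eapply is_RInt_ext; [ | apply (is_RInt_opp (V := R_NormedModule)); apply D].
  intros t. rewrite Rmin_left, Rmax_right by lra. intros Ht. rewrite Rabs_left by lra.
  unfold opp; simpl. ring. }
eapply Rle_trans.
- apply (Cmod_CRInt_le f (fun t => K * (Rabs t * exp (- c * t ^ 2))) (- b) b); [lra | exact Hf
    | exact Hl | ].
  apply (is_RInt_Chasles (V := R_NormedModule) _ _ 0 _ _ _ I2 I1).
- unfold plus, opp; simpl.
  replace (- c * (0 * (0 * 1))) with 0 by ring. rewrite exp_0.
  assert (H0 : 0 <= K / (2 * c)) by (apply Rle_mult_inv_pos; lra).
  replace (K / c) with (K / (2 * c) + K / (2 * c)) by (field; lra).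
  assert (P1 := Rmult_le_pos _ _ H0 (Rlt_le _ _ (exp_pos (- c * (- b * (- b * 1)))))).
  assert (P2 := Rmult_le_pos _ _ H0 (Rlt_le _ _ (exp_pos (- c * (b * (b * 1)))))).
  lra.
Qed.

Lemma double_exp_decay (c k a : R) :
  0 < c -> exists K, 0 <= K /\ forall u, a <= u -> exp (- c * exp u + k * u) <= K * exp (- u).
Proof.
intros Hc.
enough (H : exists B, forall u, a <= u -> (k + 1) * u - c * exp u <= B).
{ destruct H as [B HB]. exists (exp B). split; [apply Rlt_le, exp_pos | ].
  intros u Hu. rewrite <- exp_plus. apply exp_le. generalize (HB u Hu). lra. }
set (m := k + 1). destruct (Rle_dec m 0) as [Hm | Hm].
- exists (m * a). intros u Hu.
  assert (0 < c * exp u) by (apply Rmult_lt_0_compat; [easy | apply exp_pos]). nra.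
- assert (Hmc : 0 < m / c) by (apply Rdiv_lt_0_compat; lra).
  (* The maximum of m u - c exp(u), attained at u = ln(m/c); the inequality is the tangent bound for
     exp at that point. *)
  exists (m * (ln (m / c) - 1)). intros u _.
  assert (E : c * exp u = m * exp (u - ln (m / c))).
  { unfold Rminus. rewrite exp_plus, exp_Ropp, exp_ln by easy. field. split; lra. }
  rewrite E. generalize (exp_ineq1_le (u - ln (m / c))). nra.
Qed.

(** Integrate the derivative of exp(s w) for s in [0, 1]. *)
Lemma Cmod_Cexp_sub_1 (w : C) : Cmod (Cexp w - RtoC 1)%C <= Cmod w * exp (Cmod w).
Proof.
assert (H : CRInt (fun s => w * Cexp (RtoC s * w))%C 0 1 (Cexp (RtoC 1 * w) - Cexp (RtoC 0 * w))%C).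
{ apply (CRInt_derive (fun s => Cexp (RtoC s * w))).
  - intros s _. apply Ccurve_derive_Cexp.
    replace w with (RtoC 1 * w + RtoC s * RtoC 0)%C at 1 by ring.
    apply Ccurve_derive_mult; [apply Ccurve_horizontal | apply Ccurve_derive_const].
  - intros s _. apply Ccont_mult; [apply Ccont_const | ].
    apply Ccont_Cexp, Ccont_mult; [apply Ccont_horizontal | apply Ccont_const]. }
rewrite Cmult_1_l, Cmult_0_l, Cexp_0 in H.
replace (Cmod w * exp (Cmod w)) with ((1 - 0) * (Cmod w * exp (Cmod w))) by ring.
apply (Cmod_CRInt_le (fun s => w * Cexp (RtoC s * w))%C (fun _ => Cmod w * exp (Cmod w)) 0 1);
  [lra | | exact H | apply (is_RInt_const (V := R_NormedModule))].
intros s Hs. rewrite Cmod_mult, Cmod_Cexp.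
apply Rmult_le_compat_l; [apply Cmod_ge_0 | ]. apply exp_le.
rewrite re_scal_l. generalize (re_le_Cmod w) (Rle_abs (Re w)) (Cmod_ge_0 w). intros. nra.
Qed.

(** * Hankel's formula for [1 / Gamma] *)

(** The integrand [exp(w) w^(-z) dw] of Hankel's formula in the coordinate [s = ln w]. *)
Definition gam (z s : C) : C := Cexp (Cexp s + (RtoC 1 - z) * s).

Definition gam' (z s : C) : C := ((Cexp s + (RtoC 1 - z)) * gam z s)%C.

Lemma Cmod_gam (z : C) (u t : R) :
  Cmod (gam z (u, t)) = exp (exp u * cos t + (1 - Re z) * u + Im z * t).
Proof.
unfold gam. rewrite Cmod_Cexp. f_equal. destruct z as [a b]; simpl. unfold Re, Im; simpl. ring.
Qed.

Lemma cderiv_gam (z s : C) : cderiv (gam z) s (gam' z s).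
Proof.
eapply cderiv_eq.
- apply cderiv_Cexp, cderiv_plus.
  + apply (cderiv_Cexp (fun s => s)), cderiv_id.
  + apply cderiv_mult; [apply cderiv_const | apply cderiv_id].
- unfold gam', gam. ring.
Qed.

Lemma Ccont_gam {T : UniformSpace} (z : C) (f : T -> C) (x : T) :
  Ccont f x -> Ccont (fun y => gam z (f y)) x.
Proof.
intros H. apply Ccont_Cexp, Ccont_plus; [now apply Ccont_Cexp | ].
apply Ccont_mult; [apply Ccont_const | exact H].
Qed.

Lemma Ccont_id_C (s : C) : Ccont (T := C_UniformSpace) (fun z => z) s.
Proof. apply continuous_id. Qed.

Lemma holo_strip_gam (z : C) (a0 c d : R) : holo_strip (gam z) (gam' z) a0 c d.
Proof.
split; intros u t _ _.
- apply filter_forall. intros s. apply cderiv_gam.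
- apply Ccont_mult; [ | apply Ccont_gam, Ccont_id_C].
  apply Ccont_plus; [apply Ccont_Cexp, Ccont_id_C | apply Ccont_const].
Qed.

(** For |t| between [phi] and [PI], cos t <= cos phi < 0, so |exp w| = exp(exp(u) cos t) beats the
    power of |w|. The bound is uniform in [t], as rotation of the rays requires. *)
Lemma gam_decay (z : C) (a phi : R) :
  PI / 2 < phi <= PI ->
  exists K, 0 <= K /\ forall u t, a <= u -> phi <= Rabs t <= PI ->
    Cmod (gam z (u, t)) <= K * exp (- u).
Proof.
intros Hphi.
assert (Hc : cos phi < 0) by (apply cos_lt_0; lra).
destruct (double_exp_decay (- cos phi) (1 - Re z) a) as [K [HK HKu]]; [lra | ].
exists (exp (Rabs (Im z) * PI) * K). split.
{ apply Rmult_le_pos; [apply Rlt_le, exp_pos | easy]. }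
intros u t Hu Ht.
rewrite Cmod_gam, Rmult_assoc.
eapply Rle_trans; [ | apply Rmult_le_compat_l; [apply Rlt_le, exp_pos | now apply HKu]].
rewrite <- exp_plus. apply exp_le.
assert (Hcos : cos t <= cos phi).
{ replace (cos t) with (cos (Rabs t)).
  - apply cos_decr_1; lra.
  - unfold Rabs. destruct (Rcase_abs t); [apply cos_neg | easy]. }
assert (Hz : Im z * t <= Rabs (Im z) * PI).
{ eapply Rle_trans; [apply Rle_abs | ]. rewrite Rabs_mult.
  apply Rmult_le_compat_l; [apply Rabs_pos | lra]. }
generalize (exp_pos u). nra.
Qed.

Lemma gam_segment_bounded (z : C) (a phi t : R) :
  - phi <= t <= phi ->
  Cmod (gam z (a, t)) <= exp (exp a + Rabs ((1 - Re z) * a) + Rabs (Im z) * phi).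
Proof.
intros Ht. rewrite Cmod_gam. apply exp_le.
assert (exp a * cos t <= exp a).
{ generalize (exp_pos a) (COS_bound t). nra. }
assert (Im z * t <= Rabs (Im z) * phi).
{ eapply Rle_trans; [apply Rle_abs | ]. rewrite Rabs_mult.
  apply Rmult_le_compat_l; [apply Rabs_pos | ]. apply Rabs_le. lra. }
generalize (Rle_abs ((1 - Re z) * a)). lra.
Qed.

Lemma gam_contour_bounded (z : C) (a phi : R) :
  PI / 2 < phi <= PI -> exists M, 0 <= M /\ contour_bounded (gam z) a phi M.
Proof.
intros Hphi. destruct (gam_decay z a phi Hphi) as [K [HK HKu]].
set (M := exp (exp a + Rabs ((1 - Re z) * a) + Rabs (Im z) * phi)).
assert (HM : 0 < M) by apply exp_pos.
assert (HP := PI_RGT_0).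
assert (HR : forall u s, Rabs s = phi -> a <= u -> Cmod (gam z (u, s)) <= (K + M) * exp (- u)).
{ intros u s Hs Hu. eapply Rle_trans; [apply (HKu u s Hu); lra | ].
  generalize (exp_pos (- u)). nra. }
exists (K + M). split; [lra | repeat split].
- intros t Ht. generalize (gam_segment_bounded z a phi t Ht). fold M. lra.
- intros u Hu. apply HR; [ | easy]. rewrite Rabs_left; lra.
- intros u Hu. apply HR; [ | easy]. rewrite Rabs_right; lra.
Qed.

Lemma ex_hankel_gam (z : C) (a phi : R) :
  PI / 2 < phi <= PI -> exists l, hankel (gam z) a phi l.
Proof.
intros Hphi. destruct (gam_contour_bounded z a phi Hphi) as [M [HM HB]].
assert (HP := PI_RGT_0).
apply (ex_hankel _ a phi M); [lra | easy | | easy].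
apply (holo_strip_contour_cont _ (gam' z) (a - 1)); [lra | apply holo_strip_gam | lra].
Qed.

Lemma PI_admissible : PI / 2 < PI <= PI.
Proof. generalize PI_RGT_0. lra. Qed.

(** [Hk z] is [2 pi i / Gamma(z)]. *)
Definition Hk (z : C) : C :=
  proj1_sig (constructive_indefinite_description _ (ex_hankel_gam z 0 PI PI_admissible)).

(** The integrand is entire in [s], so the contour can be moved to any abscissa and then rotated
    from the angle [PI] to [phi]. *)
Lemma Hk_spec (z : C) (a phi : R) : PI / 2 < phi <= PI -> hankel (gam z) a phi (Hk z).
Proof.
intros Hphi. assert (HP := PI_RGT_0).
assert (H0 : hankel (gam z) 0 PI (Hk z)) by (unfold Hk;
  now destruct constructive_indefinite_description).
assert (Ha : hankel (gam z) a PI (Hk z)).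
{ destruct (Rle_dec 0 a) as [Ha | Ha].
  - apply (hankel_shift _ (gam' z) (-1) 0); try lra; [apply holo_strip_gam | easy].
  (* [hankel_shift] moves contours only to the right, so for negative [a] the integral at [a] is
     moved to 0 and identified there by uniqueness. *)
  - destruct (ex_hankel_gam z a PI PI_admissible) as [l Hl].
    rewrite (hankel_unique (gam z) 0 PI (Hk z) l); try easy.
    apply (hankel_shift _ (gam' z) (a - 1) a); try lra; [apply holo_strip_gam | easy]. }
destruct (gam_decay z a phi Hphi) as [K [HK HKu]].
apply (hankel_rotate _ (gam' z) (a - 1) a phi PI K); try easy; try lra.
apply holo_strip_gam.
Qed.

Lemma Cray_derive (f df : R -> C) (a K : R) :
  0 <= K ->
  (forall u, a <= u -> Ccurve_derive f u (df u)) ->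
  (forall u, a <= u -> Ccont df u) ->
  (forall u, a <= u -> Cmod (f u) <= K * exp (- u)) ->
  Cray df a (- f a)%C.
Proof.
intros HK Hf Hdf HB.
apply (Cray_lim _ (fun b => f b - f a)%C).
- intros b Hb. apply CRInt_derive; intros u; rewrite Rmin_left by easy; intros Hu; [apply Hf
    | apply Hdf]; lra.
- apply filterlim_locally. intros e.
  destruct (exp_opp_small K e HK (cond_pos e)) as [M0 HM0].
  exists (Rmax a M0). intros b Hb.
  apply C_NormedModule_mixin_compat1.
  replace (minus (f b - f a)%C (- f a)%C) with (f b)
    by (unfold minus; change (f b = (f b - f a) + - - f a)%C; ring).
  apply Rle_lt_trans with (K * exp (- b)).
  + apply HB. generalize (Rmax_l a M0); lra.
  + apply HM0. generalize (Rmax_r a M0); lra.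
Qed.

(** Since [G] vanishes at infinity along the rays, only its values at the two corners remain, and
    they cancel between rays and segment. *)
Lemma hankel_derive (G G' : C -> C) (a0 a phi M : R) :
  0 <= phi -> holo_strip G G' a0 (- phi) phi -> a0 < a ->
  0 <= M -> contour_bounded G a phi M -> hankel G' a phi (RtoC 0).
Proof.
intros Hphi HG Ha HM (_ & B1 & B3).
assert (HG'h : forall u t, a <= u -> - phi <= t <= phi -> Ccont (fun u => G' (u, t)) u).
{ intros u t Hu Ht. apply (continuous_comp (fun u => (u, t) : C_UniformSpace) G').
  - apply Ccont_horizontal.
  - apply HG; [lra | easy]. }
assert (HG'v : forall t, - phi <= t <= phi -> Ccont (fun t => G' (a, t)) t).
{ intros t Ht. apply (continuous_comp (fun t => (a, t) : C_UniformSpace) G').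
  - apply Ccont_vertical.
  - apply HG; [lra | easy]. }
assert (HGd := holo_strip_cderiv G G' a0 (- phi) phi).
exists (- G (a, (- phi)%R))%C, (G (a, phi) - G (a, (- phi)%R))%C, (- G (a, phi))%C.
repeat split.
- apply (Cray_derive (fun u => G (u, (- phi)%R)) (fun u => G' (u, (- phi)%R)) a M); try easy.
  + intros u Hu. apply cderiv_horizontal, HGd; [easy | lra | lra].
  + intros u Hu. apply HG'h; lra.
- apply (CRInt_derive (fun t => G (a, t)) (fun t => Ci * G' (a, t))%C);
    intros t; rewrite Rmin_left, Rmax_right by lra; intros Ht.
  + apply cderiv_vertical, HGd; [easy | lra | lra].
  + apply Ccont_mult; [apply Ccont_const | now apply HG'v].
- apply (Cray_derive (fun u => G (u, phi)) (fun u => G' (u, phi)) a M); try easy.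
  + intros u Hu. apply cderiv_horizontal, HGd; [easy | lra | lra].
  + intros u Hu. apply HG'h; lra.
- ring.
Qed.

(** Because [gam z s] equals [Cexp s * gam (z + 1) s], the derivative of [gam (z + 1)] is
    [gam z - z * gam (z + 1)], and its contour integral vanishes. *)
Lemma Hk_rec (z : C) : Hk z = (z * Hk (z + RtoC 1))%C.
Proof.
assert (HP := PI_RGT_0).
destruct (gam_contour_bounded (z + RtoC 1) 0 PI PI_admissible) as [M [HM HB]].
assert (H0 : hankel (gam' (z + RtoC 1)) 0 PI (RtoC 0)).
{ apply (hankel_derive (gam (z + RtoC 1)) _ (-1) 0 PI M); try easy; try lra.
  apply holo_strip_gam. }
apply (hankel_unique (gam z) 0 PI); [apply Hk_spec, PI_admissible | ].
assert (H1 := hankel_plus _ _ _ _ _ _ H0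
  (hankel_scal z _ _ _ _ (Hk_spec (z + RtoC 1) 0 PI PI_admissible))).
rewrite Cplus_0_l in H1.
eapply hankel_ext; [ | exact H1].
intros s; simpl. unfold gam', gam.
replace (Cexp s + (RtoC 1 - z) * s)%C
  with (Cexp s + (RtoC 1 - (z + RtoC 1)) * s + s)%C by ring.
rewrite (Cexp_plus _ s). ring.
Qed.

(** For z = 1 the integrand exp(exp s) has period 2 pi i, so the rays at [PI] and [- PI] cancel and
    the segment alone carries the value. On the circle of radius [r] it is within O(r) of 2 pi i,
    while [Hk] does not depend on [r]. *)
Lemma Hk_1 : Hk (RtoC 1) = (RtoC (2 * PI) * Ci)%C.
Proof.
assert (HP := PI_RGT_0).
assert (HV : forall a, CRInt (fun t => Ci * gam (RtoC 1) (a, t))%C (- PI) PI (Hk (RtoC 1))).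
{ intros a. destruct (Hk_spec (RtoC 1) a PI PI_admissible) as (l1 & l2 & l3 & L1 & L2 & L3 & ->).
  replace (- l1 + l2 + l3)%C with l2; [exact L2 | ].
  rewrite (Cray_unique (fun u => gam (RtoC 1) (u, (- PI)%R)) a l1 l3); [ring | exact L1 | ].
  eapply Cray_ext; [ | exact L3].
  intros u; simpl. unfold gam.
  replace (RtoC 1 - RtoC 1)%C with (RtoC 0) by ring.
  rewrite !Cmult_0_l, !Cplus_0_r. f_equal.
  unfold Cexp; simpl. rewrite cos_neg, sin_neg, sin_PI. now rewrite Ropp_0. }
assert (HB : forall r, 0 < r <= 1 -> Cmod (Hk (RtoC 1) - RtoC (2 * PI)
  * Ci)%C <= 2 * PI * exp 1 * r).
{ intros r Hr.
  assert (Hc : CRInt (fun _ => - Ci)%C (- PI) PI (- (RtoC (2 * PI) * Ci))%C).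
  { assert (Hc := is_RInt_const (V := C_R_NormedModule) (- PI) PI (- Ci)%C).
    replace (- (RtoC (2 * PI) * Ci))%C with (scal (PI - - PI) (- Ci)%C : C); [exact Hc | ].
    rewrite scal_R_Cmult. replace (PI - - PI) with (2 * PI) by ring. ring. }
  assert (HI := CRInt_plus _ _ _ _ _ _ (HV (ln r)) Hc).
  replace (2 * PI * exp 1 * r) with ((PI - - PI) * (r * exp 1)) by ring.
  apply (Cmod_CRInt_le (fun x => Ci * gam (RtoC 1) (ln r, x) + - Ci)%C (fun _ => r * exp 1) (- PI)
    PI);
    [lra | | exact HI | apply (is_RInt_const (V := R_NormedModule))].
  intros t _.
  replace (Ci * gam (RtoC 1) (ln r, t) + - Ci)%C with (Ci * (Cexp (Cexp (ln r, t)) - RtoC 1))%C.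
  - rewrite Cmod_mult, Cmod_Ci, Rmult_1_l.
    assert (E : Cmod (Cexp (ln r, t)) = r).
    { rewrite Cmod_Cexp. unfold Re; simpl. apply exp_ln; lra. }
    eapply Rle_trans; [apply Cmod_Cexp_sub_1 | ]. rewrite E.
    apply Rmult_le_compat_l; [lra | apply exp_le; lra].
  - unfold gam. replace (RtoC 1 - RtoC 1)%C with (RtoC 0) by ring.
    rewrite Cmult_0_l, Cplus_0_r. ring. }
apply Ceq_minus, Cmod_eq_0.
set (X := Cmod _) in *. assert (HX : 0 <= X) by apply Cmod_ge_0.
destruct (Req_dec X 0) as [E | E]; [easy | exfalso].
set (B := 2 * PI * exp 1) in *.
assert (HB0 : 0 < B) by (unfold B; apply Rmult_lt_0_compat; [lra | apply exp_pos]).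
(* With this radius the bound [B * r] is at most X/2, which contradicts X > 0. *)
set (r := Rmin 1 (X / (2 * B))).
assert (Hr1 : r <= 1) by apply Rmin_l.
assert (Hr2 : r <= X / (2 * B)) by apply Rmin_r.
assert (Hr0 : 0 < r).
{ apply Rmin_glb_lt; [lra | apply Rdiv_lt_0_compat; lra]. }
assert (H1 := HB r (conj Hr0 Hr1)).
assert (H2 : B * r <= B * (X / (2 * B))) by (apply Rmult_le_compat_l; lra).
replace (B * (X / (2 * B))) with (X / 2) in H2 by (field; lra). lra.
Qed.

(** * Comparison with the Euler-Gauss limit *)

Lemma Hk_rising (z : C) (n : nat) :
  Hk z = (rising z n * Hk (z + RtoC (INR n + 1)))%C.
Proof.
induction n as [ | n IH].
- simpl. rewrite Rplus_0_l. apply Hk_rec.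
- change (rising z (S n)) with (rising z n * (z + RtoC (INR (S n))))%C.
  rewrite IH, (Hk_rec (z + RtoC (INR n + 1))), S_INR, !RtoC_plus.
  rewrite <- Cmult_assoc. do 3 f_equal. ring.
Qed.

Lemma Hk_fact (n : nat) :
  (RtoC (INR (fact n)) * Hk (RtoC (INR n + 1)))%C = (RtoC (2 * PI) * Ci)%C.
Proof.
induction n as [ | n IH].
- simpl. rewrite Rplus_0_l, Hk_1. apply Cmult_1_l.
- rewrite <- IH, (Hk_rec (RtoC (INR n + 1))).
  change (fact (S n)) with (S n * fact n)%nat. rewrite mult_INR, S_INR, RtoC_mult.
  rewrite <- RtoC_plus. ring.
Qed.

(** [n^(n+z) exp(w) w^(-n-z) dw / w], the Hankel integrand of [1 / Gamma(z+n+1)]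
    rescaled so as to have size [exp n] at the saddle point [s = ln n]. *)
Definition gam_scaled (n : nat) (z s : C) : C :=
  Cexp (Cexp s - (z + RtoC (INR n)) * (s - RtoC (ln (INR n)))).

Lemma gam_scaled_eq (n : nat) (z s : C) :
  gam_scaled n z s =
  (Cexp ((z + RtoC (INR n)) * RtoC (ln (INR n))) * gam (z + RtoC (INR n + 1)) s)%C.
Proof.
unfold gam_scaled, gam. rewrite <- Cexp_plus. f_equal. rewrite RtoC_plus. ring.
Qed.

Lemma hankel_gam_scaled (n : nat) (z : C) (a : R) :
  hankel (gam_scaled n z) a PI
    (Cexp ((z + RtoC (INR n)) * RtoC (ln (INR n))) * Hk (z + RtoC (INR n + 1)))%C.
Proof.
eapply hankel_ext; [ | apply hankel_scal, Hk_spec, PI_admissible].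
intros s. symmetry. apply gam_scaled_eq.
Qed.

Lemma Ccont_gam_scaled {T : UniformSpace} (n : nat) (z : C) (f : T -> C) (x : T) :
  Ccont f x -> Ccont (fun y => gam_scaled n z (f y)) x.
Proof.
intros Hf. apply Ccont_Cexp, Ccont_minus; [apply Ccont_Cexp; exact Hf | ].
apply Ccont_mult; [apply Ccont_const | ].
apply Ccont_minus; [exact Hf | apply Ccont_const].
Qed.

(** Put u = ln n + v with v >= 0. Since exp(v) >= 1 + v, the exponent is at most PI M - n - (2n - M)
    v. The hypothesis M + 1 <= 2n turns this into a bound with exp(-v) = n exp(-u). *)
Lemma gam_scaled_ray (n : nat) (z : C) (M u t : R) :
  (1 <= n)%nat -> Cmod z <= M -> M + 1 <= 2 * INR n -> ln (INR n) <= u ->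
  cos t = -1 -> Rabs t = PI ->
  Cmod (gam_scaled n z (u, t)) <= exp (PI * M - INR n) * INR n * exp (- u).
Proof.
intros Hn Hz HM Hu Hc Ht.
assert (Hn0 : 0 < INR n) by (apply lt_0_INR; lia).
unfold gam_scaled. rewrite Cmod_Cexp.
replace (exp (PI * M - INR n) * INR n * exp (- u))
  with (exp (PI * M - INR n + ln (INR n) + - u)) by (rewrite !exp_plus, exp_ln; easy).
apply exp_le.
set (v := u - ln (INR n)).
replace (Re _) with (exp u * cos t - ((Re z + INR n) * v - Im z * t))
  by (destruct z; unfold Re, Im, v; simpl; ring).
rewrite Hc.
assert (E : exp u = INR n * exp v).
{ unfold v, Rminus. rewrite exp_plus, exp_Ropp, exp_ln by easy. field. lra. }
assert (H1 : INR n * (1 + v) <= exp u).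
{ rewrite E. apply Rmult_le_compat_l; [lra | apply exp_ineq1_le]. }
assert (H2 : Im z * t <= PI * M).
{ eapply Rle_trans; [apply Rle_abs | ]. rewrite Rabs_mult, Ht, Rmult_comm.
  apply Rmult_le_compat_l; [generalize PI_RGT_0; lra | ].
  eapply Rle_trans; [apply im_le_Cmod | easy]. }
assert (H3 : - Re z <= M).
{ eapply Rle_trans; [ | exact Hz]. eapply Rle_trans; [ | apply re_le_Cmod].
  rewrite <- Rabs_Ropp. apply Rle_abs. }
assert (Hv : 0 <= v) by (unfold v; lra).
replace (- u) with (- v - ln (INR n)) by (unfold v; ring).
nra.
Qed.

(** On the segment, passing from 0 to [z] multiplies the integrand by exp(-i z t), which is within
    O(|t|) of 1. For z = 0 the modulus is exp(n cos t), where [cos_le_quadratic] supplies the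
    Gaussian factor. *)
Lemma gam_scaled_segment (n : nat) (z : C) (t : R) :
  (1 <= n)%nat -> - PI <= t <= PI ->
  Cmod (gam_scaled n z (ln (INR n), t) - gam_scaled n (RtoC 0) (ln (INR n), t))%C
  <= Cmod z * exp (PI * Cmod z) * exp (INR n) * (Rabs t * exp (- (INR n / 18) * t ^ 2)).
Proof.
intros Hn Ht.
assert (Hn0 : 0 < INR n) by (apply lt_0_INR; lia).
set (w := (- z * (Ci * RtoC t))%C).
assert (Es : ((ln (INR n), t) - RtoC (ln (INR n)) = Ci * RtoC t)%C).
{ rewrite pair_RtoC. ring. }
assert (E : (gam_scaled n z (ln (INR n), t) - gam_scaled n (RtoC 0) (ln (INR n), t)
  = gam_scaled n (RtoC 0) (ln (INR n), t) * (Cexp w - RtoC 1))%C).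
{ unfold gam_scaled. rewrite Es.
  replace (Cexp (ln (INR n), t) - (z + RtoC (INR n)) * (Ci * RtoC t))%C
    with (Cexp (ln (INR n), t) - (RtoC 0 + RtoC (INR n)) * (Ci * RtoC t) + w)%C by (unfold w; ring).
  rewrite (Cexp_plus _ w). ring. }
assert (Ew : Cmod w = Cmod z * Rabs t).
{ unfold w. now rewrite !Cmod_mult, Cmod_opp, Cmod_Ci, Cmod_R, Rmult_1_l. }
assert (Hw : Cmod (Cexp w - RtoC 1)%C <= Cmod z * Rabs t * exp (PI * Cmod z)).
{ eapply Rle_trans; [apply Cmod_Cexp_sub_1 | ]. rewrite Ew.
  apply Rmult_le_compat_l; [apply Rmult_le_pos; [apply Cmod_ge_0 | apply Rabs_pos] | ].
  apply exp_le. rewrite Rmult_comm. apply Rmult_le_compat_r; [apply Cmod_ge_0 | ].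
  apply Rabs_le; lra. }
assert (Hg : Cmod (gam_scaled n (RtoC 0) (ln (INR n), t)) <= exp (INR n) * exp (- (INR n / 18)
  * t ^ 2)).
{ unfold gam_scaled. rewrite Es, Cmod_Cexp, <- exp_plus. apply exp_le.
  replace (Re _) with (exp (ln (INR n)) * cos t) by (unfold Re; simpl; ring).
  rewrite exp_ln by easy. generalize (cos_le_quadratic t Ht). nra. }
rewrite E, Cmod_mult.
eapply Rle_trans; [apply Rmult_le_compat; [apply Cmod_ge_0 | apply Cmod_ge_0 | exact Hg
  | exact Hw] | ].
right; ring.
Qed.

(** The scaled integrals for [z] and for 0 differ by O(e^(-n)) on the rays and by O(e^n / n) on the
    segment. Multiplication by n!/n^n = O(sqrt(n) e^(-n)) leaves O(n^(-1/2)), which is the last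
    factor of the bound. *)
Lemma Hk_asymptotic (z : C) (n : nat) :
  (1 <= n)%nat -> Cmod z + 1 <= 2 * INR n ->
  Cmod (RtoC (INR (fact n)) * Cexp (z * RtoC (ln (INR n))) * Hk (z + RtoC (INR n + 1))
        - RtoC (2 * PI) * Ci)%C
  <= exp (1 + PI * Cmod z) * (4 + 18 * Cmod z) * exp (- (ln (INR n) / 2)).
Proof.
intros Hn HM.
assert (HP := PI_RGT_0).
assert (Hn0 : 0 < INR n) by (apply lt_0_INR; lia).
set (L := ln (INR n)) in *. set (m := Cmod z) in *.
assert (Hm : 0 <= m) by apply Cmod_ge_0.
set (K := exp (PI * m - INR n) * INR n).
assert (HK : 0 <= K) by (apply Rmult_le_pos; [apply Rlt_le, exp_pos | lra]).
set (D := fun s => (gam_scaled n z s - gam_scaled n (RtoC 0) s)%C).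
assert (HR : forall u t, L <= u -> cos t = -1 -> Rabs t = PI ->
   Cmod (D (u, t)) <= 2 * K * exp (- u)).
{ intros u t Hu Hc Ht. unfold D, Cminus. eapply Rle_trans; [apply Cmod_triangle | ].
  rewrite Cmod_opp.
  replace (2 * K * exp (- u)) with (K * exp (- u) + K * exp (- u)) by ring.
  apply Rplus_le_compat; apply gam_scaled_ray; try easy.
  now rewrite Cmod_0. }
assert (HcD : forall {T : UniformSpace} (f : T -> C) x, Ccont f x -> Ccont (fun y => D (f y)) x).
{ intros T f x Hf. apply Ccont_minus; now apply Ccont_gam_scaled. }
set (d := (Cexp ((z + RtoC (INR n)) * RtoC L) * Hk (z + RtoC (INR n + 1))
   - Cexp (RtoC (INR n) * RtoC L) * Hk (RtoC (INR n + 1)))%C).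
assert (HD : hankel D L PI d).
{ assert (H1 := hankel_plus _ _ _ _ _ _ (hankel_gam_scaled n z L)
    (hankel_scal (RtoC (-1)) _ _ _ _ (hankel_gam_scaled n (RtoC 0) L))).
  fold L in H1. rewrite !Cplus_0_l in H1.
  replace d with (Cexp ((z + RtoC (INR n)) * RtoC L) * Hk (z + RtoC (INR n + 1))
    + RtoC (-1) * (Cexp (RtoC (INR n) * RtoC L) * Hk (RtoC (INR n + 1))))%C by (unfold d; ring).
  eapply hankel_ext; [ | exact H1]. intros s; unfold D; simpl; ring. }
assert (Hd : Cmod d <= 4 * exp (PI * m - INR n) + 18 * m * exp (PI * m + INR n) / INR n).
{ destruct HD as (l1 & l2 & l3 & L1 & L2 & L3 & ->).
  assert (E : K * exp (- L) = exp (PI * m - INR n)).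
  { unfold K, L. rewrite exp_Ropp, exp_ln by easy. field. lra. }
  assert (N1 : Cmod l1 <= 2 * K * exp (- L)).
  { apply (Cmod_Cray_exp_le (fun u => D (u, (- PI)%R)) L (2 * K)); try easy; [lra | | ].
    - intros u Hu. apply HcD, Ccont_horizontal.
    - intros u Hu. apply HR; [exact Hu | now rewrite cos_neg, cos_PI | rewrite Rabs_left; lra]. }
  assert (N3 : Cmod l3 <= 2 * K * exp (- L)).
  { apply (Cmod_Cray_exp_le (fun u => D (u, PI)) L (2 * K)); try easy; [lra | | ].
    - intros u Hu. apply HcD, Ccont_horizontal.
    - intros u Hu. apply HR; [exact Hu | apply cos_PI | rewrite Rabs_right; lra]. }
  assert (N2 : Cmod l2 <= m * exp (PI * m) * exp (INR n) / (INR n / 18)).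
  { apply (gaussian_moment_le (INR n / 18) PI _ (fun t => Ci * D (L, t))%C); [lra | lra | |
      | exact L2].
    - repeat apply Rmult_le_pos; try easy; apply Rlt_le, exp_pos.
    - intros t Ht. rewrite Cmod_mult, Cmod_Ci, Rmult_1_l. unfold D, m. apply gam_scaled_segment;
        [exact Hn | exact Ht]. }
  eapply Rle_trans; [apply Cmod_triangle | ].
  eapply Rle_trans; [apply Rplus_le_compat_r, Cmod_triangle | ].
  rewrite Cmod_opp.
  replace (18 * m * exp (PI * m + INR n) / INR n) with (m * exp (PI * m) * exp (INR n)
    / (INR n / 18))
    by (rewrite exp_plus; field; lra).
  lra. }
(* [q] is n!/n^n, the factor that undoes the scaling in [gam_scaled]. *)
set (q := INR (fact n) * exp (- (INR n * L))).
assert (Hq : 0 <= q <= exp (1 + L / 2 - INR n)).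
{ split; [apply Rmult_le_pos; [apply pos_INR | apply Rlt_le, exp_pos] | ].
  unfold q. eapply Rle_trans.
  - apply Rmult_le_compat_r; [apply Rlt_le, exp_pos | now apply fact_le_exp].
  - rewrite <- exp_plus. apply exp_le. fold L. lra. }
(* By [Hk_fact], 2 pi i is n! times [Hk] at n + 1, so both terms of the goal are scaled contour
   integrals. *)
replace (_ - _)%C with (RtoC q * d)%C.
2: { rewrite <- (Hk_fact n). unfold d, q.
  rewrite Cmult_plus_distr_r, Cexp_plus.
  rewrite <- (RtoC_mult (INR n) L), Cexp_RtoC, exp_Ropp, RtoC_mult, RtoC_inv
    by (apply Rgt_not_eq, exp_pos).
  field. apply RtoC_neq_0. apply Rgt_not_eq, exp_pos. }
rewrite Cmod_mult, Cmod_R, Rabs_right by lra.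
eapply Rle_trans; [apply Rmult_le_compat; [lra | apply Cmod_ge_0 | apply Hq | exact Hd] | ].
assert (HLn : L <= INR n).
{ unfold L. rewrite <- (ln_exp (INR n)) at 2. apply ln_le; [easy | ].
  generalize (exp_ineq1_le (INR n)). lra. }
assert (E1 : exp (1 + L / 2 - INR n) * exp (PI * m - INR n) <= exp (1 + PI * m) * exp (- (L / 2))).
{ rewrite <- !exp_plus. apply exp_le. lra. }
assert (E2 : exp (1 + L / 2 - INR n) * (exp (PI * m + INR n) / INR n) = exp (1 + PI * m)
  * exp (- (L / 2))).
{ replace (exp (PI * m + INR n) / INR n) with (exp (PI * m + INR n + - L))
    by (rewrite exp_plus, (exp_Ropp L); unfold L; rewrite exp_ln; easy).
  rewrite <- !exp_plus. f_equal. field. }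
replace (18 * m * exp (PI * m + INR n) / INR n) with (18 * m * (exp (PI * m + INR n) / INR n))
  by (field; lra).
rewrite Rmult_plus_distr_l.
replace (exp (1 + L / 2 - INR n) * (18 * m * (exp (PI * m + INR n) / INR n)))
  with (18 * m * (exp (1 + L / 2 - INR n) * (exp (PI * m + INR n) / INR n))) by ring.
rewrite E2. lra.
Qed.

Lemma Hk_Gauss_limit (z : C) :
  filterlim (fun n => RtoC (INR (fact n)) * Cexp (z * RtoC (ln (INR n)))
    * Hk (z + RtoC (INR n + 1)))%C
    eventually (locally (T := C_UniformSpace) (RtoC (2 * PI) * Ci)%C).
Proof.
apply filterlim_locally. intros e.
set (B := exp (1 + PI * Cmod z) * (4 + 18 * Cmod z)).
assert (Hz := Cmod_ge_0 z).
assert (HB : 0 <= B).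
{ apply Rmult_le_pos; [apply Rlt_le, exp_pos | lra]. }
destruct (exp_opp_small B e HB (cond_pos e)) as [M HM].
(* Beyond this [N], n >= exp(2M) gives (ln n)/2 >= M, and n >= |z| + 1 gives the size condition of
   [Hk_asymptotic]. *)
destruct (nfloor_ex (Rabs (exp (2 * M)) + Cmod z + 1)) as [N [_ HN]].
{ generalize (Rabs_pos (exp (2 * M))). lra. }
exists (S N). intros n Hn.
assert (HnN : INR (S N) <= INR n) by now apply le_INR.
rewrite S_INR in HnN.
assert (HE : exp (2 * M) <= INR n).
{ generalize (Rle_abs (exp (2 * M))). lra. }
apply C_NormedModule_mixin_compat1.
eapply Rle_lt_trans.
- apply Hk_asymptotic; [lia | ]. generalize (Rabs_pos (exp (2 * M))); lra.
- apply HM. assert (2 * M <= ln (INR n)); [ | lra].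
  rewrite <- (ln_exp (2 * M)). apply ln_le; [apply exp_pos | easy].
Qed.

Lemma two_pi_i_neq_0 : (RtoC (2 * PI) * Ci)%C <> RtoC 0.
Proof.
apply Cmult_neq_0; [ | exact Ci_nz].
apply RtoC_neq_0. generalize PI_RGT_0; lra.
Qed.

Lemma rising_pole (z : C) (k : nat) : z = RtoC (- INR k) -> rising z k = RtoC 0.
Proof.
intros Hz. destruct k as [ | k].
- simpl in *. rewrite Hz. now rewrite Ropp_0.
- change (rising z (S k)) with (rising z k * (z + RtoC (INR (S k))))%C.
  rewrite Hz at 2. rewrite <- RtoC_plus, Rplus_opp_l. apply Cmult_0_r.
Qed.

Lemma rising_neq_0 (z : C) (n : nat) : ~ Gamma_pole z -> rising z n <> RtoC 0.
Proof.
intros Hz. assert (W : forall k, (z + RtoC (INR k))%C <> RtoC 0).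
{ intros k E. apply Hz. exists k. rewrite RtoC_opp.
  replace z with ((z + RtoC (INR k)) - RtoC (INR k))%C by ring. rewrite E. ring. }
induction n as [ | n IH].
- simpl. rewrite <- (Cplus_0_r z). exact (W O).
- change (rising z (S n)) with (rising z n * (z + RtoC (INR (S n))))%C.
  now apply Cmult_neq_0.
Qed.

(** Away from the poles the rising factors are nonzero, so a zero at [z] would propagate to all
    [z + n + 1]. The sequence of [Hk_Gauss_limit] would then be constantly 0, while its limit is 2
    pi i. *)
Lemma Hk_neq_0 (z : C) : ~ Gamma_pole z -> Hk z <> RtoC 0.
Proof.
intros Hz E.
apply two_pi_i_neq_0.
apply (filterlim_locally_unique (K := R_AbsRing) (V := C_R_NormedModule) (F := eventually)
  _ _ _ (Hk_Gauss_limit z)).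
apply (filterlim_ext (fun _ => RtoC 0)); [ | apply filterlim_const].
intros n.
assert (H := Hk_rising z n). rewrite E in H.
replace (Hk (z + RtoC (INR n + 1))) with (RtoC 0); [ring | ].
transitivity (/ rising z n * (rising z n * Hk (z + RtoC (INR n + 1))))%C.
- rewrite <- H. ring.
- field. now apply rising_neq_0.
Qed.

(** At a pole the last factor of [rising z k] is 0, in agreement with the convention for
    [inv_Gamma]. Elsewhere [Hk_rising] rewrites [Gauss_seq z n] as n! n^z Hk(z + n + 1) / Hk(z),
    whose limit is 2 pi i / Hk(z). *)
Lemma inv_Gamma_Hk (z : C) : Hk z = (RtoC (2 * PI) * Ci * inv_Gamma z)%C.
Proof.
unfold inv_Gamma. destruct excluded_middle_informative as [[k Hk0] | Hz].
- rewrite (Hk_rising z k), (rising_pole z k Hk0). ring.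
- assert (HkN := Hk_neq_0 z Hz).
  assert (HL : filterlim (Gauss_seq z) eventually
    (locally (T := C_UniformSpace) (RtoC (2 * PI) * Ci * / Hk z)%C)).
  { eapply filterlim_ext.
    2: { eapply filterlim_comp; [exact (Hk_Gauss_limit z) | ].
      apply (Ccont_mult (T := C_UniformSpace) (fun w => w) (fun _ => / Hk z)%C);
        [apply Ccont_id_C | apply Ccont_const]. }
    intros n; simpl. unfold Gauss_seq. rewrite (Hk_rising z n).
    assert (HR := rising_neq_0 z n Hz). field. split; [exact HR | ].
    intros E. apply HkN. rewrite (Hk_rising z n), E. ring. }
  assert (EG : CGamma z = (RtoC (2 * PI) * Ci * / Hk z)%C).
  { apply (iota_unique (V := C_CompleteNormedModule)).
    - intros y Hy.
      exact (filterlim_locally_unique (K := R_AbsRing) (V := C_R_NormedModule) (F := eventually)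
        _ _ _ Hy HL).
    - exact HL. }
  rewrite EG. field. repeat split; try easy; [exact Ci_nz | ].
  apply RtoC_neq_0. generalize PI_RGT_0; lra.
Qed.

(** * Unordered double series *)

Definition Rsum_pairs (f : nat -> nat -> R) (L : list (nat * nat)) : R :=
  fold_right Rplus 0 (map (fun p => f (fst p) (snd p)) L).

Definition square (N : nat) : list (nat * nat) := list_prod (seq 0 N) (seq 0 N).

Lemma in_square (N : nat) (p : nat * nat) : In p (square N) <-> (fst p < N /\ snd p < N)%nat.
Proof.
destruct p as [n m]; unfold square; simpl.
rewrite in_prod_iff, !in_seq. lia.
Qed.

Lemma incl_square (L : list (nat * nat)) : exists N, incl L (square N).
Proof.
induction L as [ | p L [N HN]].
- exists 0%nat. easy.
- exists (S (fst p + snd p + N)). intros r [<- | Hr].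
  + apply in_square. lia.
  + apply HN, in_square in Hr. apply in_square. lia.
Qed.

Lemma NoDup_list_prod {A B : Type} (l1 : list A) (l2 : list B) :
  NoDup l1 -> NoDup l2 -> NoDup (list_prod l1 l2).
Proof.
intros H1 H2. induction H1 as [ | x l1 Hx H1 IH]; simpl; [constructor | ].
apply NoDup_app.
- apply FinFun.Injective_map_NoDup; [congruence | easy].
- exact IH.
- intros [u v] Hu Hv. apply in_map_iff in Hu. destruct Hu as [w [E _]].
  apply in_prod_iff in Hv. apply Hx. now replace x with u by congruence.
Qed.

Lemma NoDup_square (N : nat) : NoDup (square N).
Proof. apply NoDup_list_prod; apply seq_NoDup. Qed.

Lemma Rsum_pairs_nonneg (f : nat -> nat -> R) (L : list (nat * nat)) :
  (forall n m, 0 <= f n m) -> 0 <= Rsum_pairs f L.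
Proof.
intros Hf. unfold Rsum_pairs. induction L as [ | p L IH]; simpl; [lra | ].
generalize (Hf (fst p) (snd p)). lra.
Qed.

Lemma Rsum_pairs_app (f : nat -> nat -> R) (L M : list (nat * nat)) :
  Rsum_pairs f (L ++ M) = Rsum_pairs f L + Rsum_pairs f M.
Proof.
unfold Rsum_pairs. induction L as [ | p L IH]; simpl; [ring | ]. rewrite IH; ring.
Qed.

Lemma Rsum_pairs_incl (f : nat -> nat -> R) (L M : list (nat * nat)) :
  (forall n m, 0 <= f n m) -> NoDup L -> incl L M -> Rsum_pairs f L <= Rsum_pairs f M.
Proof.
intros Hf HL. revert M. induction HL as [ | p L Hp HL IH]; intros M HM.
- now apply Rsum_pairs_nonneg.
- destruct (in_split p M) as (M1 & M2 & ->); [apply HM; now left | ].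
  assert (Hi : incl L (M1 ++ M2)).
  { intros r Hr. assert (H := HM r (or_intror Hr)).
    apply in_app_or in H. apply in_or_app. destruct H as [H | [<- | H]]; [now left | easy
      | now right]. }
  generalize (IH _ Hi). rewrite !Rsum_pairs_app. unfold Rsum_pairs; simpl. lra.
Qed.

Lemma Cmod_sum_pairs_le (a : nat -> nat -> C) (f : nat -> nat -> R) (L : list (nat * nat)) :
  (forall n m, Cmod (a n m) <= f n m) -> Cmod (sum_pairs a L) <= Rsum_pairs f L.
Proof.
intros H. unfold sum_pairs, Rsum_pairs. induction L as [ | p L IH]; simpl.
- rewrite Cmod_0. lra.
- eapply Rle_trans; [apply Cmod_triangle | ]. apply Rplus_le_compat; [apply H | exact IH].
Qed.

Lemma sum_pairs_perm (a : nat -> nat -> C) (L M : list (nat * nat)) :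
  Permutation L M -> sum_pairs a L = sum_pairs a M.
Proof.
unfold sum_pairs. induction 1; simpl; [easy | now f_equal | ring | congruence].
Qed.

Lemma sum_pairs_app (a : nat -> nat -> C) (L M : list (nat * nat)) :
  sum_pairs a (L ++ M) = (sum_pairs a L + sum_pairs a M)%C.
Proof.
unfold sum_pairs. induction L as [ | p L IH]; simpl; [ring | ]. rewrite IH; ring.
Qed.

Lemma sum_pairs_scal (c : C) (a : nat -> nat -> C) (L : list (nat * nat)) :
  sum_pairs (fun n m => c * a n m)%C L = (c * sum_pairs a L)%C.
Proof.
unfold sum_pairs. induction L as [ | p L IH]; simpl; [ring | ]. rewrite IH; ring.
Qed.

(** Used to split an arbitrary large index list into a square, where the sum is known, and a
    disjoint remainder, where it is small. *)
Lemma NoDup_incl_complement (L0 L : list (nat * nat)) :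
  NoDup L0 -> NoDup L -> incl L0 L ->
  exists M, NoDup (L0 ++ M) /\ Permutation L (L0 ++ M).
Proof.
intros H0. revert L. induction H0 as [ | p L0 Hp H0 IH]; intros L HL Hi.
- now exists L.
- destruct (in_split p L) as (L1 & L2 & ->); [apply Hi; now left | ].
  assert (HP : Permutation (L1 ++ p :: L2) (p :: L1 ++ L2)) by (symmetry; apply Permutation_middle).
  assert (HL' := NoDup_remove_1 _ _ _ HL).
  destruct (IH (L1 ++ L2) HL') as [M [HM1 HM2]].
  { intros r Hr. assert (H := Hi r (or_intror Hr)).
    apply in_app_or in H. apply in_or_app. destruct H as [H | [<- | H]]; [now left | easy
      | now right]. }
  exists M. split.
  + simpl. constructor; [ | easy].
    intros H. apply (NoDup_remove_2 _ _ _ HL).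
    apply (Permutation_in _ (Permutation_sym HM2) H).
  + rewrite HP. simpl. now constructor.
Qed.

Lemma Rsum_pairs_list_prod (f g : nat -> R) (l1 l2 : list nat) :
  Rsum_pairs (fun n m => f n * g m) (list_prod l1 l2)
  = fold_right Rplus 0 (map f l1) * fold_right Rplus 0 (map g l2).
Proof.
induction l1 as [ | n l1 IH]; simpl.
- unfold Rsum_pairs; simpl. ring.
- rewrite Rsum_pairs_app, IH. rewrite Rmult_plus_distr_r. f_equal.
  clear IH. unfold Rsum_pairs. induction l2 as [ | m l2 IH]; simpl; [ring | ].
  rewrite IH. ring.
Qed.

Lemma sum_pairs_list_prod (f g : nat -> C) (l1 l2 : list nat) :
  sum_pairs (fun n m => f n * g m)%C (list_prod l1 l2)
  = (fold_right Cplus (RtoC 0) (map f l1) * fold_right Cplus (RtoC 0) (map g l2))%C.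
Proof.
induction l1 as [ | n l1 IH]; simpl.
- unfold sum_pairs; simpl. ring.
- rewrite sum_pairs_app, IH. rewrite Cmult_plus_distr_r. f_equal.
  clear IH. unfold sum_pairs. induction l2 as [ | m l2 IH]; simpl; [ring | ].
  rewrite IH. ring.
Qed.

Lemma fold_right_Rplus_app (l m : list R) :
  fold_right Rplus 0 (l ++ m) = fold_right Rplus 0 l + fold_right Rplus 0 m.
Proof. induction l as [ | x l IH]; simpl; [ring | rewrite IH; ring]. Qed.

Lemma fold_right_Cplus_app (l m : list C) :
  fold_right Cplus (RtoC 0) (l ++ m) = (fold_right Cplus (RtoC 0) l + fold_right Cplus (RtoC 0)
    m)%C.
Proof. induction l as [ | x l IH]; simpl; [ring | rewrite IH; ring]. Qed.

Lemma geom_half (N : nat) :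
  fold_right Rplus 0 (map (pow (/ 2)) (seq 0 N)) = 2 - 2 * (/ 2) ^ N.
Proof.
induction N as [ | N IH]; [simpl; ring | ].
rewrite seq_S, map_app, fold_right_Rplus_app, IH. simpl. field.
Qed.

Lemma Cgeom (X : C) (N : nat) :
  ((RtoC 1 - X) * fold_right Cplus (RtoC 0) (map (Cpow X) (seq 0 N)) = RtoC 1 - X ^ N)%C.
Proof.
induction N as [ | N IH]; [simpl; ring | ].
rewrite seq_S, map_app, fold_right_Cplus_app, Cmult_plus_distr_l, IH. simpl. ring.
Qed.

(** Convergence along squares becomes convergence along all finite sets because the geometric
    majorant controls whatever lies outside the square. *)
Lemma is_double_series_geometric (a : nat -> nat -> C) (l : C) (K K' : R) :
  (forall n m, Cmod (a n m) <= K * ((/ 2) ^ n * (/ 2) ^ m)) ->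
  (forall N, Cmod (sum_pairs a (square N) - l) <= K' * (/ 2) ^ N) ->
  is_double_series a l.
Proof.
intros Ha Hl e He.
assert (HK : 0 <= K).
{ generalize (Ha 0%nat 0%nat) (Cmod_ge_0 (a 0%nat 0%nat)); simpl; lra. }
assert (HK' : 0 <= K').
{ generalize (Hl 0%nat) (Cmod_ge_0 (sum_pairs a (square 0) - l)); simpl; lra. }
(* The total error will be at most (8K + K') 2^(-N); the added 1 keeps the denominator positive. *)
destruct (pow_lt_1_zero (/ 2)) with (y := e / (8 * K + K' + 1)) as [N HN].
{ rewrite Rabs_right; lra. }
{ apply Rdiv_lt_0_compat; lra. }
exists (square N). intros L HL Hi.
destruct (NoDup_incl_complement (square N) L (NoDup_square N) HL Hi) as [M [HM HP]].
rewrite (sum_pairs_perm _ _ _ HP), sum_pairs_app.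
set (f := fun n m => (/ 2) ^ n * (/ 2) ^ m).
assert (Hf : forall n m, 0 <= f n m) by (intros n m; apply Rmult_le_pos; apply pow_le; lra).
(* With q = 2^(-N), the square carries (2 - 2q)^2 out of a total of 4, so at most 8q is left outside
   it. *)
assert (HfM : Rsum_pairs f M <= 8 * (/ 2) ^ N).
{ destruct (incl_square (square N ++ M)) as [N' HN'].
  assert (H := Rsum_pairs_incl f _ _ Hf HM HN').
  unfold square, f in H. rewrite Rsum_pairs_app, !Rsum_pairs_list_prod, !geom_half in H.
  fold f in H.
  assert (0 <= (/ 2) ^ N <= 1).
  { split; [apply pow_le; lra | ]. rewrite <- (pow1 N). apply pow_incr; lra. }
  assert (0 <= (/ 2) ^ N' <= 1).
  { split; [apply pow_le; lra | ]. rewrite <- (pow1 N'). apply pow_incr; lra. }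
  nra. }
assert (HaM : Cmod (sum_pairs a M) <= 8 * K * (/ 2) ^ N).
{ eapply Rle_trans; [apply (Cmod_sum_pairs_le a (fun n m => K * f n m)), Ha | ].
  replace (Rsum_pairs (fun n m => K * f n m) M) with (K * Rsum_pairs f M); [nra | ].
  clear. unfold Rsum_pairs. induction M as [ | p M IH]; simpl; [ring | rewrite <- IH; ring]. }
replace (sum_pairs a (square N) + sum_pairs a M - l)%C
  with ((sum_pairs a (square N) - l) + sum_pairs a M)%C by ring.
eapply Rle_lt_trans; [apply Cmod_triangle | ].
specialize (HN N (le_n N)). rewrite Rabs_right in HN by (apply Rle_ge, pow_le; lra).
apply Rle_lt_trans with ((8 * K + K') * (/ 2) ^ N).
{ generalize (Hl N). lra. }
apply Rle_lt_trans with ((8 * K + K') * (e / (8 * K + K' + 1))).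
{ apply Rmult_le_compat_l; lra. }
apply Rmult_lt_reg_r with (8 * K + K' + 1); [lra | ].
replace ((8 * K + K') * (e / (8 * K + K' + 1)) * (8 * K + K' + 1)) with ((8 * K + K') * e)
  by (field; lra).
lra.
Qed.

Lemma is_double_series_scal (c : C) (a : nat -> nat -> C) (l : C) :
  is_double_series a l -> is_double_series (fun n m => c * a n m)%C (c * l)%C.
Proof.
intros H e He.
assert (Hc := Cmod_ge_0 c).
destruct (H (e / (Cmod c + 1))) as [L0 HL0]; [apply Rdiv_lt_0_compat; lra | ].
exists L0. intros L HL Hi. specialize (HL0 L HL Hi).
rewrite sum_pairs_scal.
replace (c * sum_pairs a L - c * l)%C with (c * (sum_pairs a L - l))%C by ring.
rewrite Cmod_mult.
apply Rle_lt_trans with (Cmod c * (e / (Cmod c + 1))).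
- apply Rmult_le_compat_l; lra.
- apply Rmult_lt_reg_r with (Cmod c + 1); [lra | ].
  replace (Cmod c * (e / (Cmod c + 1)) * (Cmod c + 1)) with (Cmod c * e) by (field; lra). lra.
Qed.

Lemma is_double_series_unique (a : nat -> nat -> C) (l m : C) :
  is_double_series a l -> is_double_series a m -> l = m.
Proof.
intros Hl Hm. apply Ceq_minus, Cmod_eq_0.
destruct (Req_dec (Cmod (l - m)) 0) as [E | E]; [easy | exfalso].
assert (H0 : 0 < Cmod (l - m) / 2) by (generalize (Cmod_ge_0 (l - m)); lra).
destruct (Hl _ H0) as [L1 H1]. destruct (Hm _ H0) as [L2 H2].
set (dec := fun p q : nat * nat => excluded_middle_informative (p = q)).
(* A common duplicate-free index list, at which both limits are within half their distance. *)
set (L := nodup dec (L1 ++ L2)).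
assert (HL : NoDup L) by apply NoDup_nodup.
specialize (H1 L HL). specialize (H2 L HL).
assert (A1 : incl L1 L) by (intros p Hp; apply nodup_In, in_or_app; now left).
assert (A2 : incl L2 L) by (intros p Hp; apply nodup_In, in_or_app; now right).
specialize (H1 A1). specialize (H2 A2).
assert (T : Cmod (l - m) <= Cmod (sum_pairs a L - l) + Cmod (sum_pairs a L - m)).
{ rewrite <- (Cmod_opp (sum_pairs a L - l)).
  eapply Rle_trans; [ | apply Cmod_triangle].
  right. f_equal. ring. }
lra.
Qed.

Lemma Double_series_eq (a : nat -> nat -> C) (l : C) :
  is_double_series a l -> Double_series a = l.
Proof.
intros H. apply (iota_unique (V := C_CompleteNormedModule)); [ | exact H].
intros y Hy. now apply (is_double_series_unique a).
Qed.

Lemma is_double_series_ext (a b : nat -> nat -> C) (l : C) :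
  (forall n m, a n m = b n m) -> is_double_series a l -> is_double_series b l.
Proof.
intros E H e He. destruct (H e He) as [L0 HL0]. exists L0. intros L HL Hi.
replace (sum_pairs b L) with (sum_pairs a L); [now apply HL0 | ].
unfold sum_pairs. f_equal. apply map_ext. intros p. apply E.
Qed.

(** * The Mittag-Leffler kernel *)

(** No decay estimate is asked for at [a]: the rays from [a] converge because they differ from those
    at [b] by proper integrals. The value is then found by shifting back to the right. *)
Lemma hankel_shift_left (G G' : C -> C) (a0 a b phi : R) (l : C) :
  0 <= phi -> holo_strip G G' a0 (- phi) phi -> a0 < a -> a <= b ->
  hankel G b phi l -> hankel G a phi l.
Proof.
intros Hphi HG Ha Hab HL.
assert (Hex : exists m, hankel G a phi m).
{ destruct HL as (l1 & l2 & l3 & L1 & L2 & L3 & _).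
  assert (HI : forall t, - phi <= t <= phi -> exists m, CRInt (fun u => G (u, t)) a b m).
  { intros t Ht. apply ex_CRInt. intros u. rewrite Rmin_left, Rmax_right by lra. intros Hu.
    apply (holo_strip_cont_h G G' a0 (- phi) phi); [easy | lra | lra]. }
  destruct (HI (- phi)) as [m1 M1]; [lra | ].
  destruct (HI phi) as [m3 M3]; [lra | ].
  destruct (ex_CRInt (fun t => Ci * G (a, t))%C (- phi) phi) as [m2 M2].
  { intros t. rewrite Rmin_left, Rmax_right by lra. intros Ht.
    apply Ccont_mult; [apply Ccont_const | ].
    apply (holo_strip_cont_v G G' a0 (- phi) phi); [easy | lra | lra]. }
  exists (- (l1 - - m1) + m2 + (l3 - - m3))%C, (l1 - - m1)%C, m2, (l3 - - m3)%C.
  repeat split; try easy; (apply (Cray_Chasles _ b a); [apply CRInt_swap | ]; easy). }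
destruct Hex as [m Hm].
rewrite (hankel_unique G b phi l m); try easy.
now apply (hankel_shift G G' a0 a b).
Qed.

Lemma hankel_0 (a phi : R) : hankel (fun _ => RtoC 0) a phi (RtoC 0).
Proof.
assert (HI : forall c d, CRInt (fun _ => RtoC 0) c d (RtoC 0)).
{ intros c d. assert (H : CRInt (fun _ => RtoC 0) c d (RtoC 0 - RtoC 0)%C).
  { apply (CRInt_derive (fun _ => RtoC 0)); intros; [apply Ccurve_derive_const
      | apply Ccont_const]. }
  now replace (RtoC 0 - RtoC 0)%C with (RtoC 0) in H by ring. }
assert (HR : Cray (fun _ => RtoC 0) a (RtoC 0)).
{ apply (Cray_lim _ (fun _ => RtoC 0)); [intros; apply HI | apply filterlim_const]. }
exists (RtoC 0), (RtoC 0), (RtoC 0). repeat split; try exact HR; [ | ring].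
eapply CRInt_ext; [ | apply HI]. intros t; simpl; ring.
Qed.

Lemma hankel_sum_pairs (T : nat -> nat -> C -> C) (h : nat -> nat -> C) (a phi : R)
  (L : list (nat * nat)) :
  (forall n m, hankel (T n m) a phi (h n m)) ->
  hankel (fun s => sum_pairs (fun n m => T n m s) L) a phi (sum_pairs h L).
Proof.
intros H. unfold sum_pairs. induction L as [ | p L IH]; simpl.
- apply hankel_0.
- apply hankel_plus; [apply H | exact IH].
Qed.

Lemma locally_neq_0 (z : C) :
  z <> RtoC 0 -> locally (T := C_UniformSpace) z (fun w => w <> RtoC 0).
Proof.
intros Hz. apply Cmod_gt_0 in Hz.
(* Balls are those of the product structure, so radius |z|/2 only yields |w - z| < sqrt(2) |z|/2,
   which is still at most |z|. *)
assert (Hz2 : 0 < Cmod z / 2) by lra.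
exists (mkposreal _ Hz2). intros w Hw E.
apply C_NormedModule_mixin_compat2 in Hw. simpl in Hw.
rewrite E in Hw.
change (Cmod (RtoC 0 - z)%C < sqrt 2 * (Cmod z / 2)) in Hw.
replace (RtoC 0 - z)%C with (- z)%C in Hw by ring. rewrite Cmod_opp in Hw.
assert (sqrt 2 <= 2).
{ rewrite <- (sqrt_Rsqr 2) at 2 by lra. apply sqrt_le_1; unfold Rsqr; lra. }
nra.
Qed.

(** With w = zeta^(1/(alpha beta)), zeta^(1/alpha) is w^beta and zeta^(1/beta) is w^alpha; hence [y]
    goes with [beta] and [x] with [alpha]. *)
Definition kernel_den (alpha beta : R) (x y s : C) : C :=
  ((Cexp (RtoC beta * s) - y) * (Cexp (RtoC alpha * s) - x))%C.

(** The integrand after substitution. Since d zeta = alpha beta zeta ds, the Jacobian absorbs the -1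
    in the exponent of zeta and leaves w^(1 + alpha + beta - mu); the constant alpha beta stays
    outside. *)
Definition kernel (alpha beta : R) (mu x y s : C) : C :=
  (gam (mu - RtoC (alpha + beta)) s / kernel_den alpha beta x y s)%C.

Definition kernel_den' (alpha beta : R) (x y s : C) : C :=
  (RtoC beta * Cexp (RtoC beta * s) * (Cexp (RtoC alpha * s) - x)
   + (Cexp (RtoC beta * s) - y) * (RtoC alpha * Cexp (RtoC alpha * s)))%C.

Definition kernel' (alpha beta : R) (mu x y s : C) : C :=
  (gam' (mu - RtoC (alpha + beta)) s * / kernel_den alpha beta x y s
   + gam (mu - RtoC (alpha + beta)) s
     * (- kernel_den' alpha beta x y s
        / (kernel_den alpha beta x y s * kernel_den alpha beta x y s)))%C.

Lemma cderiv_Cexp_scal (c s : C) :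
  cderiv (fun s => Cexp (c * s)) s (c * Cexp (c * s))%C.
Proof.
eapply cderiv_eq.
- apply (cderiv_Cexp (fun z => c * z)%C), (cderiv_mult (fun _ => c) (fun z => z));
    [apply cderiv_const | apply cderiv_id].
- ring.
Qed.

Lemma cderiv_kernel_den (alpha beta : R) (x y s : C) :
  cderiv (kernel_den alpha beta x y) s (kernel_den' alpha beta x y s).
Proof.
eapply cderiv_eq.
- apply cderiv_mult; (apply cderiv_minus; [apply cderiv_Cexp_scal | apply cderiv_const]).
- unfold kernel_den'. ring.
Qed.

Lemma cderiv_kernel (alpha beta : R) (mu x y s : C) :
  kernel_den alpha beta x y s <> RtoC 0 ->
  cderiv (kernel alpha beta mu x y) s (kernel' alpha beta mu x y s).
Proof.
intros H0.
apply (cderiv_mult (gam (mu - RtoC (alpha + beta))) (fun s => / kernel_den alpha beta x y s)%C);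
  [apply cderiv_gam | ].
apply (cderiv_inv (kernel_den alpha beta x y)); [exact H0 | apply cderiv_kernel_den].
Qed.

Lemma Ccont_kernel_den (alpha beta : R) (x y s : C) :
  Ccont (T := C_UniformSpace) (kernel_den alpha beta x y) s.
Proof.
apply Ccont_mult; (apply Ccont_minus; [ | apply Ccont_const]);
  apply Ccont_scal_exp, Ccont_id_C.
Qed.

Lemma Ccont_kernel' (alpha beta : R) (mu x y s : C) :
  kernel_den alpha beta x y s <> RtoC 0 ->
  Ccont (T := C_UniformSpace) (kernel' alpha beta mu x y) s.
Proof.
intros H0. assert (HD := Ccont_kernel_den alpha beta x y s).
assert (Hg : Ccont (T := C_UniformSpace) (gam (mu - RtoC (alpha + beta))) s)
  by (apply Ccont_gam, Ccont_id_C).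
assert (Hg' : Ccont (T := C_UniformSpace) (gam' (mu - RtoC (alpha + beta))) s).
{ destruct s as [u t].
  apply (proj2 (holo_strip_gam (mu - RtoC (alpha + beta)) (u - 1) t t)); lra. }
assert (Hd' : Ccont (T := C_UniformSpace) (kernel_den' alpha beta x y) s).
{ assert (HE : forall c : R, Ccont (T := C_UniformSpace) (fun s => Cexp (RtoC c * s)) s)
    by (intros c; apply Ccont_scal_exp, Ccont_id_C).
  apply Ccont_plus; apply Ccont_mult.
  - apply Ccont_mult; [apply Ccont_const | apply HE].
  - apply Ccont_minus; [apply HE | apply Ccont_const].
  - apply Ccont_minus; [apply HE | apply Ccont_const].
  - apply Ccont_mult; [apply Ccont_const | apply HE]. }
apply Ccont_plus; apply Ccont_mult.
- exact Hg'.
- apply Ccont_inv; [exact H0 | exact HD].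
- exact Hg.
- apply Ccont_mult; [apply Ccont_opp; exact Hd' | ].
  apply (Ccont_inv (fun s => kernel_den alpha beta x y s * kernel_den alpha beta x y s)%C).
  + now apply Cmult_neq_0.
  + apply Ccont_mult; exact HD.
Qed.

(** Nonvanishing of the denominator on the closed strip extends by continuity to the neighbourhoods
    that [holo_strip] requires. *)
Lemma holo_strip_kernel (alpha beta : R) (mu x y : C) (a0 c d : R) :
  (forall u t, a0 < u -> c <= t <= d -> kernel_den alpha beta x y (u, t) <> RtoC 0) ->
  holo_strip (kernel alpha beta mu x y) (kernel' alpha beta mu x y) a0 c d.
Proof.
intros H0. split; intros u t Hu Ht; [ | apply Ccont_kernel'; now apply H0].
assert (HP : locally (T := C_UniformSpace) (u, t) (fun s => kernel_den alpha beta x y s <> RtoC 0)).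
{ apply (Ccont_kernel_den alpha beta x y (u, t) (fun z => z <> RtoC 0)).
  apply locally_neq_0. now apply H0. }
revert HP. apply filter_imp. intros s. apply cderiv_kernel.
Qed.

Lemma contour_bounded_le (F G : C -> C) (a phi M c : R) :
  0 <= c -> (forall s, a <= fst s -> Cmod (G s) <= c * Cmod (F s)) ->
  contour_bounded F a phi M -> contour_bounded G a phi (c * M).
Proof.
intros Hc HG (B1 & B2 & B3).
repeat split; [intros t Ht | intros u Hu | intros u Hu]; rewrite ?Rmult_assoc;
  (eapply Rle_trans; [apply HG; simpl; lra | apply Rmult_le_compat_l; [easy | ]]).
- now apply B1.
- now apply B2.
- now apply B3.
Qed.

Lemma contour_cont_Ccont (G : C -> C) (a phi : R) :
  (forall s, a <= fst s -> Ccont (T := C_UniformSpace) G s) -> contour_cont G a phi.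
Proof.
intros H. repeat split; [intros t Ht | intros u Hu | intros u Hu].
- apply (continuous_comp (fun t => (a, t) : C_UniformSpace) G); [apply Ccont_vertical | apply H;
    simpl; lra].
- apply (continuous_comp (fun u => (u, (- phi)%R) : C_UniformSpace) G); [apply Ccont_horizontal
    | now apply H].
- apply (continuous_comp (fun u => (u, phi) : C_UniformSpace) G); [apply Ccont_horizontal
    | now apply H].
Qed.

(** * Geometric expansion of the kernel far to the right *)

Lemma Ccont_pow {T : UniformSpace} (f : T -> C) (n : nat) (p : T) :
  Ccont f p -> Ccont (fun q => f q ^ n)%C p.
Proof.
intros H. induction n as [ | n IH]; [apply Ccont_const | ].
now apply (Ccont_mult f (fun q => f q ^ n)%C).
Qed.

Lemma Ccont_sum_pairs {T : UniformSpace} (f : nat -> nat -> T -> C) (L : list (nat * nat)) (p : T) :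
  (forall n m, Ccont (f n m) p) -> Ccont (fun q => sum_pairs (fun n m => f n m q) L) p.
Proof.
intros H. unfold sum_pairs. induction L as [ | r L IH]; simpl; [apply Ccont_const | ].
apply (Ccont_plus (f (fst r) (snd r))); [apply H | exact IH].
Qed.

(** [x w^(-c)] in the coordinate [s = ln w]. *)
Definition ratio (c : R) (x s : C) : C := (x * Cexp (- (RtoC c * s)))%C.

Lemma ratio_small (c : R) (x : C) :
  0 < c -> exists b, forall s, b <= fst s -> Cmod (ratio c x s) <= / 2.
Proof.
intros Hc.
destruct (exp_opp_small (Cmod x) (/ 2)) as [M HM]; [apply Cmod_ge_0 | lra | ].
exists (M / c). intros s Hs.
unfold ratio. rewrite Cmod_mult, Cmod_Cexp.
replace (Re (- (RtoC c * s))) with (- (c * fst s)) by (destruct s; unfold Re; simpl; ring).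
apply Rlt_le, HM.
replace M with (c * (M / c)) by (field; lra). apply Rmult_le_compat_l; lra.
Qed.

Lemma Ccont_ratio (c : R) (x s : C) : Ccont (T := C_UniformSpace) (ratio c x) s.
Proof.
apply Ccont_mult; [apply Ccont_const | ].
apply Ccont_Cexp, Ccont_opp, Ccont_mult; [apply Ccont_const | apply Ccont_id_C].
Qed.

Lemma Cmod_one_minus_ge (X : C) : Cmod X <= / 2 -> / 2 <= Cmod (RtoC 1 - X)%C.
Proof.
intros H.
assert (T := Cmod_triangle (RtoC 1 - X) X).
replace (RtoC 1 - X + X)%C with (RtoC 1) in T by ring. rewrite Cmod_1 in T. lra.
Qed.

Lemma one_minus_neq_0 (X : C) : Cmod X <= / 2 -> (RtoC 1 - X)%C <> RtoC 0.
Proof. intros H. apply Cmod_gt_0. generalize (Cmod_one_minus_ge X H). lra. Qed.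

Lemma Cexp_sub_ratio (c : R) (x s : C) :
  (Cexp (RtoC c * s) - x = Cexp (RtoC c * s) * (RtoC 1 - ratio c x s))%C.
Proof. unfold ratio. rewrite Cexp_opp. field. apply Cexp_neq_0. Qed.

(** Factoring w^alpha w^beta out of the denominator shifts the parameter of [gam] from mu - alpha -
    beta to mu. *)
Lemma kernel_ratio (alpha beta : R) (mu x y s : C) :
  Cmod (ratio alpha x s) <= / 2 -> Cmod (ratio beta y s) <= / 2 ->
  kernel alpha beta mu x y s
  = (gam mu s / ((RtoC 1 - ratio alpha x s) * (RtoC 1 - ratio beta y s)))%C.
Proof.
intros HX HY. apply one_minus_neq_0 in HX, HY.
unfold kernel, kernel_den. rewrite !Cexp_sub_ratio.
replace (gam (mu - RtoC (alpha + beta)) s)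
  with (gam mu s * Cexp (RtoC alpha * s) * Cexp (RtoC beta * s))%C.
- field. repeat split; try easy; apply Cexp_neq_0.
- unfold gam. rewrite <- !Cexp_plus, RtoC_plus. f_equal. ring.
Qed.

Definition ML_term (alpha beta : R) (mu x y : C) (n m : nat) (s : C) : C :=
  (gam mu s * (ratio alpha x s ^ n * ratio beta y s ^ m))%C.

Definition ML_index (alpha beta : R) (mu : C) (n m : nat) : C :=
  (RtoC (INR n) * RtoC alpha + RtoC (INR m) * RtoC beta + mu)%C.

Lemma ML_term_eq (alpha beta : R) (mu x y s : C) (n m : nat) :
  ML_term alpha beta mu x y n m s = (x ^ n * y ^ m * gam (ML_index alpha beta mu n m) s)%C.
Proof.
unfold ML_term, ratio, ML_index, gam.
rewrite !Cpow_mult_l, !Cexp_pow.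
transitivity (x ^ n * y ^ m * (Cexp (Cexp s + (RtoC 1 - mu) * s)
  * Cexp (RtoC (INR n) * - (RtoC alpha * s)) * Cexp (RtoC (INR m) * - (RtoC beta * s))))%C;
      [ring | ].
rewrite <- !Cexp_plus. do 2 f_equal. ring.
Qed.

Lemma hankel_ML_term (alpha beta : R) (mu x y : C) (n m : nat) (b phi : R) :
  PI / 2 < phi <= PI ->
  hankel (ML_term alpha beta mu x y n m) b phi (x ^ n * y ^ m * Hk (ML_index alpha beta mu n m))%C.
Proof.
intros Hphi. eapply hankel_ext; [ | apply hankel_scal, Hk_spec, Hphi].
intros s. symmetry. apply ML_term_eq.
Qed.

(** Over a square the double sum is a product of two finite geometric sums, so its distance to the
    kernel is explicit. *)
Lemma sum_ML_term (alpha beta : R) (mu x y s : C) (N : nat) :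
  Cmod (ratio alpha x s) <= / 2 -> Cmod (ratio beta y s) <= / 2 ->
  sum_pairs (fun n m => ML_term alpha beta mu x y n m s) (square N)
  = (kernel alpha beta mu x y s * ((RtoC 1 - ratio alpha x s ^ N)
    * (RtoC 1 - ratio beta y s ^ N)))%C.
Proof.
intros HX HY. rewrite (kernel_ratio alpha beta mu x y s HX HY).
apply one_minus_neq_0 in HX, HY.
unfold ML_term. rewrite sum_pairs_scal. unfold square.
rewrite (sum_pairs_list_prod (Cpow (ratio alpha x s)) (Cpow (ratio beta y s))).
rewrite <- (Cgeom (ratio alpha x s) N), <- (Cgeom (ratio beta y s) N).
field. now split.
Qed.

Lemma Cmod_kernel_le (alpha beta : R) (mu x y s : C) :
  Cmod (ratio alpha x s) <= / 2 -> Cmod (ratio beta y s) <= / 2 ->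
  Cmod (kernel alpha beta mu x y s) <= 4 * Cmod (gam mu s).
Proof.
intros HX HY. rewrite (kernel_ratio alpha beta mu x y s HX HY).
assert (NX := one_minus_neq_0 _ HX). assert (NY := one_minus_neq_0 _ HY).
apply Cmod_one_minus_ge in HX, HY.
rewrite Cmod_div, Cmod_mult by now apply Cmult_neq_0.
set (p := Cmod (RtoC 1 - ratio alpha x s)%C) in *. set (q := Cmod (RtoC 1 - ratio beta y s)%C) in *.
unfold Rdiv. rewrite (Rmult_comm 4).
apply Rmult_le_compat_l; [apply Cmod_ge_0 | ].
replace 4 with (/ (/ 2 * / 2)) by field.
apply Rinv_le_contravar; nra.
Qed.

Lemma Cmod_pow_half (X : C) (n : nat) : Cmod X <= / 2 -> Cmod (X ^ n)%C <= (/ 2) ^ n.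
Proof. intros H. rewrite Cmod_pow. apply pow_incr. split; [apply Cmod_ge_0 | exact H]. Qed.

Lemma pow_half_bounds (n : nat) : 0 <= (/ 2) ^ n <= 1.
Proof. split; [apply pow_le; lra | ]. rewrite <- (pow1 n). apply pow_incr; lra. Qed.

(** Far enough to the right, the kernel is a double geometric series that converges uniformly
    along the contour. *)
Lemma hankel_kernel_right (alpha beta : R) (mu x y : C) (b phi : R) :
  PI / 2 < phi <= PI ->
  (forall s, b <= fst s -> Cmod (ratio alpha x s) <= / 2) ->
  (forall s, b <= fst s -> Cmod (ratio beta y s) <= / 2) ->
  (forall s, b <= fst s -> Ccont (T := C_UniformSpace) (kernel alpha beta mu x y) s) ->
  exists l, hankel (kernel alpha beta mu x y) b phi l /\
    is_double_series (fun n m => x ^ n * y ^ m * Hk (ML_index alpha beta mu n m))%C l.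
Proof.
intros Hphi HX HY Hcont.
assert (HP := PI_RGT_0). assert (Hphi0 : 0 <= phi) by lra.
destruct (gam_contour_bounded mu b phi Hphi) as [M [HM HB]].
set (B := 2 * phi + 2 * exp (- b)).
assert (Hker : contour_bounded (kernel alpha beta mu x y) b phi (4 * M)).
{ apply (contour_bounded_le (gam mu)); [lra | | easy].
  intros s Hs. apply Cmod_kernel_le; auto. }
destruct (ex_hankel (kernel alpha beta mu x y) b phi (4 * M)) as [l Hl]; try easy; [lra
  | now apply contour_cont_Ccont | ].
exists l. split; [exact Hl | ].
assert (HcT : forall n m s, Ccont (T := C_UniformSpace) (ML_term alpha beta mu x y n m) s).
{ intros n m s. apply Ccont_mult; [apply Ccont_gam, Ccont_id_C | ].
  apply Ccont_mult; apply Ccont_pow, Ccont_ratio. }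
(* [B] is the length factor of [Cmod_hankel_le]. The 12 is 4 * 3: the kernel is at most 4 |gam mu|,
   and (1 - X)(1 - Y) - 1 is at most 3 * 2^(-N) when |X| and |Y| are at most 2^(-N). *)
apply (is_double_series_geometric _ _ (M * B) (12 * M * B)).
- intros n m.
  replace (M * B * ((/ 2) ^ n * (/ 2) ^ m)) with ((/ 2) ^ n * (/ 2) ^ m * M * B) by ring.
  assert (Hq : 0 <= (/ 2) ^ n * (/ 2) ^ m) by (apply Rmult_le_pos; apply pow_half_bounds).
  apply (Cmod_hankel_le (ML_term alpha beta mu x y n m) b phi); [easy | now apply Rmult_le_pos
    | | | now apply hankel_ML_term].
  + apply contour_cont_Ccont. intros s _. apply HcT.
  + apply (contour_bounded_le (gam mu)); [easy | | easy].
    intros s Hs. unfold ML_term. rewrite !Cmod_mult, (Rmult_comm (Cmod (gam mu s))).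
    apply Rmult_le_compat_r; [apply Cmod_ge_0 | ].
    apply Rmult_le_compat; try apply Cmod_ge_0; apply Cmod_pow_half; auto.
- intros N.
  set (T := fun s => sum_pairs (fun n m => ML_term alpha beta mu x y n m s) (square N)).
  assert (HT : hankel T b phi (sum_pairs (fun n m => x ^ n * y ^ m * Hk (ML_index alpha beta mu n
    m))%C (square N))).
  { apply hankel_sum_pairs. intros n m. now apply hankel_ML_term. }
  assert (HcTs : forall s, Ccont (T := C_UniformSpace) T s).
  { intros s. apply Ccont_sum_pairs. intros n m. apply HcT. }
  assert (HD := hankel_plus _ _ _ _ _ _ HT (hankel_scal (RtoC (-1)) _ _ _ _ Hl)).
  replace (12 * M * B * (/ 2) ^ N) with (12 * (/ 2) ^ N * M * B) by ring.
  assert (Hq := pow_half_bounds N).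
  replace (sum_pairs _ _ - l)%C with
    (sum_pairs (fun n m => x ^ n * y ^ m * Hk (ML_index alpha beta mu n m))%C (square N)
      + RtoC (-1) * l)%C by ring.
  apply (Cmod_hankel_le (fun s => T s + RtoC (-1) * kernel alpha beta mu x y s)%C b phi); [easy
    | nra | | | exact HD].
  + apply contour_cont_Ccont. intros s Hs.
    apply Ccont_plus; [apply HcTs | apply Ccont_mult; [apply Ccont_const | now apply Hcont]].
  + apply (contour_bounded_le (gam mu)); [lra | | easy].
    intros s Hs. unfold T. rewrite sum_ML_term by auto.
    set (X := (ratio alpha x s ^ N)%C). set (Y := (ratio beta y s ^ N)%C).
    assert (NX : Cmod X <= (/ 2) ^ N) by (apply Cmod_pow_half; auto).
    assert (NY : Cmod Y <= (/ 2) ^ N) by (apply Cmod_pow_half; auto).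
    set (k := kernel alpha beta mu x y s).
    replace (k * ((RtoC 1 - X) * (RtoC 1 - Y)) + RtoC (-1) * k)%C
      with (k * (- X + - Y + X * Y))%C by ring.
    rewrite Cmod_mult.
    replace (12 * (/ 2) ^ N * Cmod (gam mu s)) with ((4 * Cmod (gam mu s)) * (3 * (/ 2) ^ N))
      by ring.
    apply Rmult_le_compat; try apply Cmod_ge_0; [apply Cmod_kernel_le; auto | ].
    eapply Rle_trans; [apply Cmod_triangle | ].
    eapply Rle_trans; [apply Rplus_le_compat_r, Cmod_triangle | ].
    rewrite !Cmod_opp, Cmod_mult.
    assert (0 <= Cmod X) by apply Cmod_ge_0. assert (0 <= Cmod Y) by apply Cmod_ge_0. nra.
Qed.

Lemma hankel_kernel (alpha beta : R) (mu x y : C) (a0 a phi : R) :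
  0 < alpha -> 0 < beta -> PI / 2 < phi <= PI -> a0 < a ->
  (forall u t, a0 < u -> - phi <= t <= phi -> kernel_den alpha beta x y (u, t) <> RtoC 0) ->
  hankel (kernel alpha beta mu x y) a phi
    (RtoC (2 * PI) * Ci * mittag_leffler2 (RtoC alpha) (RtoC beta) x y mu)%C.
Proof.
intros Halpha Hbeta Hphi Ha Hden.
assert (HP := PI_RGT_0).
destruct (ratio_small alpha x Halpha) as [b1 Hb1].
destruct (ratio_small beta y Hbeta) as [b2 Hb2].
set (b := Rmax a (Rmax b1 b2)).
assert (Hba : a <= b) by apply Rmax_l.
assert (Hbb1 : b1 <= b) by (eapply Rle_trans; [apply Rmax_l | apply Rmax_r]).
assert (Hbb2 : b2 <= b) by (eapply Rle_trans; [apply Rmax_r | apply Rmax_r]).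
destruct (hankel_kernel_right alpha beta mu x y b phi Hphi) as [l [Hl HS]].
- intros s Hs. apply Hb1. lra.
- intros s Hs. apply Hb2. lra.
- intros s Hs. apply Ccont_mult; [apply Ccont_gam, Ccont_id_C | ].
  apply (Ccont_inv (kernel_den alpha beta x y)); [ | apply Ccont_kernel_den].
  unfold kernel_den. rewrite !Cexp_sub_ratio.
  repeat apply Cmult_neq_0; try apply Cexp_neq_0; apply one_minus_neq_0;
    [apply Hb2 | apply Hb1]; lra.
- replace (RtoC (2 * PI) * Ci * mittag_leffler2 (RtoC alpha) (RtoC beta) x y mu)%C with l.
  + apply (hankel_shift_left _ (kernel' alpha beta mu x y) a0 a b); try easy; [lra | ].
    now apply holo_strip_kernel.
  (* The series for [E] is the series of contour integrals divided by 2 pi i; exhibiting its sum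
     gives [Double_series] its value. *)
  + unfold mittag_leffler2.
    rewrite (Double_series_eq _ (/ (RtoC (2 * PI) * Ci) * l)%C).
    * field. split; [exact Ci_nz | apply RtoC_neq_0; lra].
    * eapply is_double_series_ext; [ | apply is_double_series_scal; exact HS].
      intros n m; simpl. rewrite inv_Gamma_Hk. unfold ML_index.
      field. split; [exact Ci_nz | apply RtoC_neq_0; lra].
Qed.

(** * Back to the original contour *)

(** Only absolute values are compared: at t = - PI the principal argument is [PI]. *)
Lemma Rabs_Carg_Cexp (v t : R) : Rabs t <= PI -> Rabs (Carg (Cexp (v, t))) = Rabs t.
Proof.
intros Ht.
assert (E : acos (Re (Cexp (v, t)) / Cmod (Cexp (v, t))) = Rabs t).
{ rewrite Cmod_Cexp. unfold Cexp, Re, Im; simpl.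
  replace (exp v * cos t / exp v) with (cos t) by (field; apply Rgt_not_eq, exp_pos).
  replace (cos t) with (cos (Rabs t)).
  - apply acos_cos. split; [apply Rabs_pos | exact Ht].
  - unfold Rabs. destruct (Rcase_abs t); [apply cos_neg | easy]. }
unfold Carg. rewrite E. destruct (Rle_dec _ _); rewrite ?Rabs_Ropp; apply Rabs_Rabsolu.
Qed.

(** Either |x| < exp(c a), and the modulus exp(c u) already exceeds |x| for [u] slightly below [a];
    or the argument of [x] exceeds c phi, which no point of the strip reaches. As c phi <= PI, the
    imaginary part c t has the absolute value of the principal argument. The strict inequality for
    |x| provides the margin a0 < a. *)
Lemma Omega_minus_avoid (c a phi : R) (x : C) :
  0 < c -> c * phi <= PI -> Omega_minus (exp (c * a)) (c * phi) x ->
  exists a0, a0 < a /\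
    forall u t, a0 < u -> - phi <= t <= phi -> Cexp (RtoC c * (u, t)) <> x.
Proof.
intros Hc Hphi Hx.
assert (Ecs : forall u t, (RtoC c * (u, t))%C = (c * u, c * t))
  by (intros u t; unfold RtoC, Cmult; simpl; apply C_eq; ring).
destruct Hx as [Hx | (H0 & Hx & _)].
- assert (H : exists a0, a0 < a /\ Cmod x <= exp (c * a0)).
  { destruct (Req_dec (Cmod x) 0) as [E | E].
    - exists (a - 1). split; [lra | ]. rewrite E. apply Rlt_le, exp_pos.
    - assert (Hpos : 0 < Cmod x) by (generalize (Cmod_ge_0 x); lra).
      exists (ln (Cmod x) / c). split.
      + apply Rmult_lt_reg_l with c; [easy | ].
        replace (c * (ln (Cmod x) / c)) with (ln (Cmod x)) by (field; lra).
        rewrite <- (ln_exp (c * a)). now apply ln_increasing.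
      + replace (c * (ln (Cmod x) / c)) with (ln (Cmod x)) by (field; lra).
        rewrite exp_ln by easy. lra. }
  destruct H as [a0 [Ha0 Hle]]. exists a0. split; [easy | ].
  intros u t Hu Ht E. rewrite <- E, Cmod_Cexp, Ecs in Hle.
  unfold Re in Hle; simpl in Hle.
  apply (Rlt_not_le (exp (c * u)) (exp (c * a0))); [ | exact Hle].
  now apply exp_increasing, Rmult_lt_compat_l.
- exists (a - 1). split; [lra | ].
  intros u t _ Ht E. rewrite <- E, Ecs, Rabs_Carg_Cexp in Hx.
  + rewrite Rabs_mult, (Rabs_right c) in Hx by lra.
    assert (Rabs t <= phi) by (apply Rabs_le; lra). nra.
  + rewrite Rabs_mult, (Rabs_right c) by lra.
    assert (Rabs t <= phi) by (apply Rabs_le; lra). nra.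
Qed.

Lemma Cray_ext_ge (f g : R -> C) (a : R) (l : C) :
  (forall x, a <= x -> f x = g x) -> Cray f a l -> Cray g a l.
Proof.
intros E.
refine (is_RInt_gen_ext (V := C_R_NormedModule) (Fa := at_point a) (Fb := Rbar_locally p_infty)
  f g l _).
apply (Filter_prod _ _ _ (fun x => x = a) (fun b => a < b)); [reflexivity | now exists a | ].
intros x b -> Hb u. simpl. rewrite Rmin_left by lra. intros Hu. apply E. lra.
Qed.

Lemma Cray_log_subst (K : R -> C) (eps p : R) (l : C) :
  0 < eps -> 0 < p -> (forall u, ln eps / p <= u -> Ccont K u) ->
  Cray K (ln eps / p) l -> Cray (fun r => RtoC (/ (p * r)) * K (ln r / p)%R)%C eps l.
Proof.
intros Heps Hp HK Hl.
assert (Hln : forall r, eps <= r -> ln eps / p <= ln r / p).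
{ intros r Hr. apply Rmult_le_compat_r; [apply Rlt_le, Rinv_0_lt_compat, Hp | now apply ln_le]. }
set (Phi := (fun b => RInt (V := C_R_CompleteNormedModule) K (ln eps / p) b) : R -> C).
assert (HPhi : forall b, ln eps / p <= b -> CRInt K (ln eps / p) b (Phi b)).
{ intros b Hb. apply (RInt_correct (V := C_R_CompleteNormedModule)).
  apply (ex_RInt_continuous (V := C_R_CompleteNormedModule)).
  intros u. rewrite Rmin_left by easy. intros Hu. now apply HK. }
apply (Cray_lim _ (fun b => Phi (ln b / p))).
- intros b Hb.
  eapply CRInt_ext; [intros r; apply scal_R_Cmult | ].
  apply (is_RInt_comp (V := C_R_CompleteNormedModule) K (fun r => ln r / p) (fun r => / (p * r))).
  + intros r. rewrite Rmin_left, Rmax_right by easy. intros Hr. apply HK, Hln; lra.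
  + intros r. rewrite Rmin_left, Rmax_right by easy. intros Hr. split.
    * auto_derive; [lra | field; lra].
    * apply (ex_derive_continuous (V := R_NormedModule) (fun r => / (p * r))).
      auto_derive. apply Rmult_integral_contrapositive; lra.
- apply (filterlim_comp _ _ _ (fun b => ln b / p) Phi _ (Rbar_locally p_infty)).
  + intros P [M HM]. exists (exp (p * M)). intros b Hb. apply HM.
    apply Rmult_lt_reg_l with p; [easy | ].
    replace (p * (ln b / p)) with (ln b) by (field; lra).
    rewrite <- (ln_exp (p * M)). apply ln_increasing; [apply exp_pos | easy].
  + now apply (Cray_lim K Phi (ln eps / p)).
Qed.

Definition zeta_integrand (alpha beta : R) (mu x y : C) (r t : R) : C :=
  (Cexp (polar_pow r t (RtoC (1 / (alpha * beta))))
   * polar_pow r t ((RtoC (1 + alpha + beta) - mu) / RtoC (alpha * beta) - RtoC 1)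
   / ((polar_pow r t (RtoC (1 / alpha)) - y)
      * (polar_pow r t (RtoC (1 / beta)) - x)))%C.

(** Here [t] is the argument carried by the contour and not the principal one, so the identity also
    holds on both sides of the cut. *)
Lemma polar_pow_log (p r t : R) (c : C) :
  0 < p -> polar_pow r t c = Cexp (c * RtoC p * (ln r / p, t / p)).
Proof.
intros Hp. unfold polar_pow. f_equal.
rewrite pair_RtoC, !RtoC_div by lra. field. apply RtoC_neq_0. lra.
Qed.

(** The factors [RtoC r] and [Cexp (Ci * RtoC t)] multiply to zeta, which is exp(p s) by [E5] and
    cancels the -1 in the exponent isolated by [E4]. *)
Lemma zeta_integrand_kernel (alpha beta : R) (mu x y : C) (r t : R) :
  0 < alpha -> 0 < beta -> 0 < r ->
  (RtoC r * (zeta_integrand alpha beta mu x y r t * Cexp (Ci * RtoC t)))%C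
  = kernel alpha beta mu x y (ln r / (alpha * beta), t / (alpha * beta)).
Proof.
intros Ha Hb Hr. unfold zeta_integrand, kernel, kernel_den.
set (p := alpha * beta). assert (Hp : 0 < p) by now apply Rmult_lt_0_compat.
rewrite !(polar_pow_log p r t) by easy. set (s := (ln r / p, t / p) : C).
assert (NP : RtoC p <> RtoC 0) by (apply RtoC_neq_0; lra).
assert (E1 : (RtoC (1 / p) * RtoC p = RtoC 1)%C).
{ rewrite <- RtoC_mult. f_equal. field. lra. }
assert (E2 : (RtoC (1 / alpha) * RtoC p = RtoC beta)%C).
{ rewrite <- RtoC_mult. f_equal. unfold p. field. lra. }
assert (E3 : (RtoC (1 / beta) * RtoC p = RtoC alpha)%C).
{ rewrite <- RtoC_mult. f_equal. unfold p. field. lra. }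
assert (E4 : (((RtoC (1 + alpha + beta) - mu) / RtoC p - RtoC 1) * RtoC p * s
   = (RtoC 1 - (mu - RtoC (alpha + beta))) * s + - (RtoC p * s))%C).
{ rewrite !RtoC_plus. field. exact NP. }
rewrite E1, E2, E3, E4, Cmult_1_l, Cexp_plus.
assert (E5 : (RtoC r * Cexp (Ci * RtoC t) = Cexp (RtoC p * s))%C).
{ unfold s. rewrite pair_RtoC, !RtoC_div by lra.
  replace (RtoC p * (RtoC (ln r) / RtoC p + Ci * (RtoC t / RtoC p)))%C
    with (RtoC (ln r) + Ci * RtoC t)%C by (field; exact NP).
  now rewrite Cexp_plus, Cexp_RtoC, exp_ln. }
unfold gam. rewrite Cexp_plus.
set (D := ((Cexp (RtoC beta * s) - y) * (Cexp (RtoC alpha * s) - x))%C).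
transitivity (Cexp (Cexp s) * Cexp ((RtoC 1 - (mu - RtoC (alpha + beta))) * s)
  * ((RtoC r * Cexp (Ci * RtoC t)) * Cexp (- (RtoC p * s))) / D)%C.
{ unfold Cdiv. ring. }
rewrite E5, Cexp_opp, Cinv_r, Cmult_1_r by apply Cexp_neq_0. reflexivity.
Qed.

Lemma is_hankel_integral_kernel (alpha beta : R) (mu x y : C) (eps theta : R) (l : C) :
  0 < alpha -> 0 < beta -> 0 < eps ->
  contour_cont (kernel alpha beta mu x y) (ln eps / (alpha * beta)) (theta / (alpha * beta)) ->
  hankel (kernel alpha beta mu x y) (ln eps / (alpha * beta)) (theta / (alpha * beta)) l ->
  is_hankel_integral (zeta_integrand alpha beta mu x y) eps theta (RtoC (alpha * beta) * l)%C.
Proof.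
intros Ha Hb Heps (_ & C1 & C3) (l1 & l2 & l3 & L1 & L2 & L3 & ->).
set (p := alpha * beta) in *. assert (Hp : 0 < p) by now apply Rmult_lt_0_compat.
set (k := kernel alpha beta mu x y) in *.
assert (HR : forall t m, (forall u, ln eps / p <= u -> Ccont (fun u => k (u, t / p)%R) u) ->
  Cray (fun u => k (u, t / p)%R) (ln eps / p) m ->
  Cray (fun r => zeta_integrand alpha beta mu x y r t * Cexp (Ci * RtoC t))%C eps (RtoC p * m)%C).
{ intros t m Hc Hm.
  apply (Cray_log_subst _ eps p m Heps Hp Hc) in Hm.
  eapply Cray_ext_ge; [ | exact (Cray_scal (RtoC p) _ _ _ Hm)].
  intros r Hr. simpl. unfold k, p. rewrite <- zeta_integrand_kernel by lra. fold p.
  rewrite RtoC_inv, RtoC_mult by (apply Rmult_integral_contrapositive; lra).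
  field. split; apply RtoC_neq_0; lra. }
exists (- (RtoC p * l1))%C, (RtoC p * l2)%C, (RtoC p * l3)%C. repeat split.
(* The incoming ray is traversed from infinity, hence the sign of the first witness. *)
- apply (is_RInt_gen_swap (V := C_R_NormedModule) (Fa := Rbar_locally p_infty)
    (Fb := at_point eps)).
  apply (HR (- theta)%R); replace (- theta / p) with (- (theta / p)) by (field; lra); easy.
- assert (H : CRInt (fun t => scal (/ p) (Ci * k (ln eps / p, / p * t + 0)%R)%C) (- theta)
    theta l2).
  { apply (is_RInt_comp_lin (V := C_R_NormedModule) (fun t => Ci * k (ln eps / p, t)%R)%C).
    replace (/ p * - theta + 0) with (- (theta / p)) by (field; lra).
    replace (/ p * theta + 0) with (theta / p) by (field; lra). exact L2. }
  eapply CRInt_ext; [ | exact (CRInt_scal (RtoC p) _ _ _ _ H)].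
  intros t. simpl. rewrite scal_R_Cmult.
  replace (/ p * t + 0) with (t / p) by (field; lra).
  unfold k, p. rewrite <- zeta_integrand_kernel by lra. fold p.
  rewrite RtoC_inv by lra. field. apply RtoC_neq_0; lra.
- now apply HR.
- ring.
Qed.

Theorem lemma2p1 :
  forall (alpha beta : R) (mu : C) (eps theta : R) (x y : C),
    0 < alpha < 2 -> 0 < beta < 2 -> alpha * beta < 2 ->
    0 < eps ->
    PI * alpha * beta / 2 < theta ->
    theta <= Rmin PI (PI * alpha * beta) ->
    let eps_alpha := Rpower eps (1 / beta) in
    let eps_beta := Rpower eps (1 / alpha) in
    let theta_alpha := theta / beta in
    let theta_beta := theta / alpha in
    theta_alpha < PI -> theta_beta < PI ->
    Omega_minus eps_alpha theta_alpha x ->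
    Omega_minus eps_beta theta_beta y ->
    exists I : C,
      is_hankel_integral
        (fun r t : R =>
           (Cexp (polar_pow r t (RtoC (1 / (alpha * beta))))
            * polar_pow r t
                ((RtoC (1 + alpha + beta) - mu) / RtoC (alpha * beta) - RtoC 1)
            / ((polar_pow r t (RtoC (1 / alpha)) - y)
               * (polar_pow r t (RtoC (1 / beta)) - x)))%C)
        eps theta I /\
      mittag_leffler2 (RtoC alpha) (RtoC beta) x y mu
        = (/ (RtoC (2 * PI) * Ci) * / RtoC (alpha * beta) * I)%C.
Proof.
intros alpha beta mu eps theta x y [Ha _] [Hb _] _ Heps Htheta1 Htheta2
  eps_alpha eps_beta theta_alpha theta_beta Hta Htb Hx Hy.
assert (HP := PI_RGT_0).
set (p := alpha * beta). assert (Hp : 0 < p) by now apply Rmult_lt_0_compat.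
set (a := ln eps / p). set (phi := theta / p).
(* Division by alpha beta turns the conditions on theta into the admissible range for the rays of
   Hankel's formula. *)
assert (Hphi : PI / 2 < phi <= PI).
{ assert (E : theta = phi * p) by (unfold phi; field; lra).
  assert (Htheta3 := Rle_trans _ _ _ Htheta2 (Rmin_r _ _)).
  replace (PI * alpha * beta) with (PI * p) in * by (unfold p; ring).
  split; apply Rnot_le_lt || apply Rnot_lt_le; intros H; nra. }
assert (Ex : alpha * phi = theta_alpha) by (unfold phi, p, theta_alpha; field; lra).
assert (Ey : beta * phi = theta_beta) by (unfold phi, p, theta_beta; field; lra).
(* [alpha * a] is ln(eps)/beta, so [exp (alpha * a)] is [eps_alpha] and [alpha * phi] is
   [theta_alpha]; the case of [y] is symmetric. *)
destruct (Omega_minus_avoid alpha a phi x) as [a1 [Ha1 H1]]; [easy | lra | | ].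
{ rewrite Ex. unfold eps_alpha, Rpower in Hx.
  replace (alpha * a) with (1 / beta * ln eps) by (unfold a, p; field; lra). exact Hx. }
destruct (Omega_minus_avoid beta a phi y) as [a2 [Ha2 H2]]; [easy | lra | | ].
{ rewrite Ey. unfold eps_beta, Rpower in Hy.
  replace (beta * a) with (1 / alpha * ln eps) by (unfold a, p; field; lra). exact Hy. }
assert (Hden : forall u t, Rmax a1 a2 < u -> - phi <= t <= phi ->
  kernel_den alpha beta x y (u, t) <> RtoC 0).
{ intros u t Hu Ht. apply Cmult_neq_0; apply Cminus_eq_contra.
  - apply H2; [ | easy]. eapply Rle_lt_trans; [apply Rmax_r | exact Hu].
  - apply H1; [ | easy]. eapply Rle_lt_trans; [apply Rmax_l | exact Hu]. }
assert (Ha0 : Rmax a1 a2 < a) by now apply Rmax_lub_lt.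
exists (RtoC p * (RtoC (2 * PI) * Ci * mittag_leffler2 (RtoC alpha) (RtoC beta) x y mu))%C.
split.
- apply (is_hankel_integral_kernel alpha beta mu x y eps theta); try easy.
  + apply (holo_strip_contour_cont _ (kernel' alpha beta mu x y) (Rmax a1 a2)); [fold p phi; lra
      | | exact Ha0].
    now apply holo_strip_kernel.
  + now apply (hankel_kernel alpha beta mu x y (Rmax a1 a2)).
- field. repeat split; try exact Ci_nz; apply RtoC_neq_0; lra.
Qed.
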